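(* Let $s=(s_1,\ldots,s_r)$ be a probability distribution on $\{1,\ldots,r\}$, and let $\rho_1,\ldots,\rho_r$ be quantum states on a finite-dimensional Hilbert space. For all $\varepsilon\in(0,1)$, $$\lim_{n\to\infty}\frac1nD_H^\varepsilon\big(\Omega_s^{(n)}\,\big\|\,\rho(s)^{\otimes n}\big)=H_s(\rho_1,\ldots,\rho_r),$$ where the left-hand side is the optimal type II error exponent for testing the arbitrarily varying null hypothesis $\Omega^{(n)}_s$ against the simple alternative $\rho(s)^{\otimes n}$, and $H_s$ is the multivariate log-Euclidean divergence.
   Context: $\mathscr D$ is the set of states (positive semi-definite, unit trace) on the given finite-dimensional complex Hilbert space. Multivariate log-Euclidean divergence: for positive definite operators, $H_s(\rho_1,\ldots,\rho_r)=-\ln\operatorname{Tr}\big[\exp\big(\sum_{i=1}^rs_i\ln\rho_i\big)\big]$; for general states $H_s(\rho_1,\ldots,\rho_r)=\sup_{\varepsilon>0}H_s(\rho_1+\varepsilon I,\ldots,\rho_r+\varepsilon I)=\lim_{\varepsilon\to0^+}H_s(\rho_1+\varepsilon I,\ldots,\rho_r+\varepsilon I)$ (possibly $+\infty$). Let $\{|i\rangle\}_{i=1}^r$ be the standard basis of $\mathbb C^r$ and set $\pi(s)=\sum_{i=1}^rs_i|i\rangle\langle i|$, $\rho(s)=\sum_{i=1}^rs_i|i\rangle\langle i|\otimes\rho_i$, and $$\Omega_s^{(n)}=\Big\{\bigotimes_{j=1}^n(\pi(s)\otimes\omega_j):\ \omega_j\in\mathscr D\ \text{for all } j\in\{1,\dots,n\}\Big\}.$$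 For an operator $M^{(n)}$ with $0\le M^{(n)}\le I^{\otimes n}$, the type I and type II error probabilities are $\alpha(M^{(n)})=\sup_{\sigma^{(n)}\in\Omega_s^{(n)}}\operatorname{Tr}[(I^{\otimes n}-M^{(n)})\sigma^{(n)}]$ and $\beta(M^{(n)})=\operatorname{Tr}[M^{(n)}\rho(s)^{\otimes n}]$. Finally $$\frac1nD_H^\varepsilon(\Omega_s^{(n)}\|\rho(s)^{\otimes n})=-\frac1n\ln\Big(\inf\big\{\beta(M^{(n)}):\ 0\le M^{(n)}\le I^{\otimes n},\ \alpha(M^{(n)})\le\varepsilon\big\}\Big),$$ with $-\ln0=+\infty$. *)

(* Defs.v *)
From HB Require Import structures.
From mathcomp Require Import all_boot all_order all_algebra.
From mathcomp Require Import sesquilinear spectral complex mxtens.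
From mathcomp Require Import all_classical all_reals all_analysis.

Set Implicit Arguments.
Unset Strict Implicit.
Unset Printing Implicit Defensive.

Import Order.TTheory GRing.Theory Num.Theory.

Local Open Scope ring_scope.
Local Open Scope classical_set_scope.
Local Open Scope complex_scope.
Local Open Scope sesquilinear_scope.

(* In R[i], [0 <= z] means that z is real and nonnegative. *)
Definition psdmx (R : realType) (d : nat) (A : 'M[R[i]]_d) : Prop :=
  A \is hermsymmx /\ forall u : 'cV[R[i]]_d, 0 <= (u ^t* *m A *m u) 0 0.

Definition loewner_le (R : realType) (d : nat) (A B : 'M[R[i]]_d) : Prop :=
  psdmx (B - A).

Definition density (R : realType) (d : nat) : set 'M[R[i]]_d :=
  [set rho | psdmx rho /\ \tr rho = 1].
Arguments density {R d} _.

(* Used for products of two Hermitian matrices and for Hermitian matrices only,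
   whose trace is real. *)
Definition rtrace (R : realType) (d : nat) (A : 'M[R[i]]_d) : R :=
  complex.Re (\tr A).

(* Functional calculus of a Hermitian matrix A = P^-1 diag(a) P, where P is
   unitary and the eigenvalues a are real: f(A) = P^-1 diag(f(a)) P. *)
Definition herm_calc (R : realType) (d : nat) (f : R -> R) (A : 'M[R[i]]_d) :
    'M[R[i]]_d :=
  invmx (spectralmx A)
    *m diag_mx (map_mx (fun z : R[i] => (f (complex.Re z))%:C) (spectral_diag A))
    *m spectralmx A.

Definition lnmx (R : realType) (d : nat) (A : 'M[R[i]]_d) : 'M[R[i]]_d :=
  herm_calc (@ln R) A.

Definition expmx (R : realType) (d : nat) (A : 'M[R[i]]_d) : 'M[R[i]]_d :=
  herm_calc (@expR R) A.

Definition log_euclidean_pd (R : realType) (r d : nat) (s : 'I_r -> R)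
    (rho : 'I_r -> 'M[R[i]]_d) : R :=
  - ln (rtrace (expmx (\sum_(i < r) (s i)%:C *: lnmx (rho i)))).

Definition log_euclidean (R : realType) (r d : nat) (s : 'I_r -> R)
    (rho : 'I_r -> 'M[R[i]]_d) : \bar R :=
  ereal_sup [set (log_euclidean_pd s (fun i => rho i + (e%:C)%:M))%:E
            | e in [set e : R | 0 < e]].

Fixpoint bigtens_rec (R : pzRingType) (d n : nat) :
    ('I_n.+1 -> 'M[R]_d) -> 'M[R]_(d ^ n.+1) :=
  match n with
  | 0 => fun A => A ord0
  | n'.+1 => fun A => A ord0 *t bigtens_rec (fun j : 'I_n'.+1 => A (lift ord0 j))
  end.

(* A_0 (x) ... (x) A_(n-1), with the same index conventions as the iterated
   tensor power [ntensmx] (see [bigtens_const]); it is 1 for n = 0. *)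
Definition bigtens (R : pzRingType) (d n : nat) :
    ('I_n -> 'M[R]_d) -> 'M[R]_(d ^ n) :=
  match n with
  | 0 => fun _ => 1
  | n'.+1 => fun A => bigtens_rec A
  end.

Lemma bigtens_const (R : pzRingType) (d n : nat) (A : 'M[R]_d) :
  bigtens (fun _ : 'I_n => A) = ntensmx A n.
Proof.
case: n => [//|n]; rewrite /bigtens /ntensmx.
by elim: n => [//|n IHn] /=; rewrite IHn.
Qed.

Definition pi_state (R : realType) (r : nat) (s : 'I_r -> R) : 'M[R[i]]_r :=
  \sum_(i < r) (s i)%:C *: delta_mx i i.

Definition rho_state (R : realType) (r d : nat) (s : 'I_r -> R)
    (rho : 'I_r -> 'M[R[i]]_d) : 'M[R[i]]_(r * d) :=
  \sum_(i < r) (s i)%:C *: (delta_mx i i *t rho i).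

Definition av_hypothesis (R : realType) (r : nat) (s : 'I_r -> R) (d n : nat) :
    set 'M[R[i]]_((r * d) ^ n) :=
  [set bigtens (fun j : 'I_n => pi_state s *t omega j)
  | omega in [set omega : 'I_n -> 'M[R[i]]_d | forall j, density (omega j)]].
Arguments av_hypothesis {R r} s d n _.

Definition is_test (R : realType) (N : nat) (M : 'M[R[i]]_N) : Prop :=
  loewner_le 0 M /\ loewner_le M 1%:M.

Definition type1_error (R : realType) (N : nat) (Omega : set 'M[R[i]]_N)
    (M : 'M[R[i]]_N) : \bar R :=
  ereal_sup [set (rtrace ((1%:M - M) *m sigma))%:E | sigma in Omega].

Definition type2_error (R : realType) (N : nat) (tau M : 'M[R[i]]_N) : R :=
  rtrace (M *m tau).

(* [lne] is the extended logarithm, with lne 0 = -oo. *)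
Definition hypothesis_testing_div (R : realType) (N : nat) (eps : R)
    (Omega : set 'M[R[i]]_N) (tau : 'M[R[i]]_N) : \bar R :=
  (- lne (ereal_inf [set (type2_error tau M)%:E
                    | M in [set M | is_test M
                                    /\ (type1_error Omega M <= eps%:E)%E]]))%E.

(* Main.v *)
(* Write pi for pi(s), k = sum_i s_i ln rho_i, l = sum_i |i><i| (x) ln rho_i, and let
   K, L be the sums of n local copies of 1 (x) k and of l.

   Direct part (rho_i replaced by rho_i + e).  The local term 1 (x) k - l has mean zero
   in every state pi (x) omega, so K - L has variance O(n) in every product null
   hypothesis, while rho(s)^n = pi^n exp L and Tr (pi^n exp K) = (Tr exp k)^n.  The
   test measures L coarsely, in randomly shifted windows, and then accepts if K is not
   much smaller than the value found; acceptance lets exp L be replaced by exp K up to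
   a subexponential factor, and Chebyshev's inequality bounds the first error.

   Converse.  For a fixed omega the strong converse of the quantum Stein lemma holds
   with rate D(pi (x) omega || rho(s)): cut off the pairs of eigenvectors with an
   atypical log-likelihood ratio, distributed as in Nussbaum and Szkola.  If the
   divergence is finite, take omega proportional to the exponential of the compression
   of sum_i s_i ln rho_i to the intersection V of the supports of the rho_i with
   s_i > 0.  The rate is then -ln Tr_V exp(...), and this is at most the divergence
   because, by Peierls' inequality, Tr exp (sum_i s_i ln (rho_i + e)) has upper limit
   at most Tr_V exp(...) as e tends to 0. *)
Require Import Defs.
From HB Require Import structures.
From mathcomp Require Import all_boot all_order all_algebra.
From mathcomp Require Import sesquilinear spectral complex mxtens.
From mathcomp Require Import zify ring lra.
From mathcomp Require Import all_classical all_reals all_analysis.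
Set Implicit Arguments.
Unset Strict Implicit.
Unset Printing Implicit Defensive.
Import Order.TTheory GRing.Theory Num.Theory.
Import complex.ComplexField.Normc.
Local Open Scope ring_scope.
Local Open Scope classical_set_scope.
Local Open Scope complex_scope.
Local Open Scope sesquilinear_scope.

(** * Moduli, traces and spectral calculus *)

(** The mean-zero property holds because the average of the blocks of l with weights s_i is k, so 1
    (x) k and l have the same expectation in pi (x) omega for every omega. Little else about the
    null states can be used: the omega_j vary with j and need not commute with k or with any rho_i,
    so only moments at single sites are available. With windows of width m about sqrt n and a
    threshold Delta proportional to n, the first error has terms of order m^2 / Delta^2, n / Delta^2
    and n^2 / (m Delta^2), which all vanish, while the factor exp (m + Delta) in the second error
    costs an arbitrarily small rate. The omega of the converse comes from the Gibbs variational
    principle: in D(pi (x) omega || rho(s)) = Tr omega ln omega - Tr omega k the terms ln s_i have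
    cancelled, and the right side is least at the normalised exponential of k, with value - ln Tr
    exp k. For singular rho_i a finite rate forces omega to live on V, whence the compression. *)

Section ComplexModulus.
Context {R : realType}.
Implicit Types (z w : R[i]) (a : R).

Definition sqmod z : R := complex.Re z ^+ 2 + complex.Im z ^+ 2.

Lemma sqmod_ge0 z : 0 <= sqmod z.
Proof. by rewrite addr_ge0// sqr_ge0. Qed.

Lemma sqmodC z : (sqmod z)%:C = z^* * z.
Proof. by rewrite /sqmod add_Re2_Im2 sqr_normc mulrC. Qed.

Lemma Re_mulJ z : complex.Re (z^* * z) = sqmod z.
Proof. by rewrite -sqmodC. Qed.

Lemma sqmodM z w : sqmod (z * w) = sqmod z * sqmod w.
Proof. by case: z w => [a b] [c d]; rewrite /sqmod /=; ring. Qed.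

Lemma sqmodJ z : sqmod z^* = sqmod z.
Proof. by case: z => a b; rewrite /sqmod /= sqrrN. Qed.

Lemma sqmod_real a : sqmod a%:C = a ^+ 2.
Proof. by rewrite /sqmod /=; ring. Qed.

Lemma sqmod0 : sqmod 0 = 0.
Proof. by rewrite /sqmod /=; ring. Qed.

Lemma sqmod1 : sqmod 1 = 1.
Proof. by rewrite /sqmod /=; ring. Qed.

Lemma sqmodD_le z w : sqmod (z + w) <= 2 * sqmod z + 2 * sqmod w.
Proof.
case: z w => [a b] [c d]; rewrite /sqmod /= -subr_ge0.
have -> : 2 * (a ^+ 2 + b ^+ 2) + 2 * (c ^+ 2 + d ^+ 2) - ((a + c) ^+ 2 + (b + d) ^+ 2) = (a - c) ^+ 2 + (b - d) ^+ 2 by ring.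
by rewrite addr_ge0 ?sqr_ge0.
Qed.

Lemma Re_le_normc z : complex.Re z <= normc z.
Proof. by case: z => a b /=; apply: (le_trans (ler_norm _)); rewrite -sqrtr_sqr ler_sqrt ?lerDl ?sqr_ge0 ?addr_ge0 ?sqr_ge0. Qed.

Lemma normc_ge0 z : 0 <= normc z.
Proof. by case: z => a b; exact: sqrtr_ge0. Qed.

Lemma normc_sqmod z : normc z = Num.sqrt (sqmod z).
Proof. by case: z. Qed.

Lemma normc_real a : 0 <= a -> normc a%:C = a.
Proof. by move=> a0; rewrite normc_sqmod sqmod_real sqrtr_sqr ger0_norm. Qed.

Lemma normc_prod n (f : 'I_n -> R[i]) :
  normc (\prod_j f j) = \prod_j normc (f j).
Proof.
elim/big_ind2: _ => [|x1 x2 y1 y2 <- <-|//]; first exact: normc1.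
exact: normcM.
Qed.

Lemma normc_sum I (r : seq I) (P : pred I) (f : I -> R[i]) :
  normc (\sum_(j <- r | P j) f j) <= \sum_(j <- r | P j) normc (f j).
Proof.
elim/big_ind2: _ => [|x1 x2 y1 y2 h1 h2|//]; first by rewrite normc0.
by apply: le_trans (le_normcD _ _) _; exact: lerD.
Qed.

Lemma Rec_sum I (r : seq I) (P : pred I) (f : I -> R[i]) :
  complex.Re (\sum_(j <- r | P j) f j) = \sum_(j <- r | P j) complex.Re (f j).
Proof. by elim/big_rec2: _ => [//|i y1 y2 _ <-]; case: (f i) y2 => [? ?] []. Qed.

Lemma RecM a z : complex.Re (a%:C * z) = a * complex.Re z.
Proof. by case: z => b c /=; ring. Qed.

Lemma RecB z w : complex.Re (z - w) = complex.Re z - complex.Re w.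
Proof. by case: z w => [a b] [c d]. Qed.

Lemma RecN z : complex.Re (- z) = - complex.Re z.
Proof. by case: z. Qed.

Lemma sumC I (r : seq I) (P : pred I) (f : I -> R) :
  (\sum_(j <- r | P j) f j)%:C = \sum_(j <- r | P j) (f j)%:C :> R[i].
Proof. by rewrite rmorph_sum. Qed.

Lemma prodC I (r : seq I) (P : pred I) (f : I -> R) :
  (\prod_(j <- r | P j) f j)%:C = \prod_(j <- r | P j) (f j)%:C :> R[i].
Proof. by rewrite rmorph_prod. Qed.

Lemma sqmod_prod n (f : 'I_n -> R[i]) :
  sqmod (\prod_j f j) = \prod_j sqmod (f j).
Proof.
elim/big_ind2: _ => [|x1 x2 y1 y2 <- <-|//]; first exact: sqmod1.
exact: sqmodM.
Qed.

End ComplexModulus.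

Section Frobenius.
Context {R : realType}.
Local Notation C := R[i].

Lemma adjE m n (A : 'M[C]_(m, n)) i j : (A ^t*) i j = (A j i)^*.
Proof. by rewrite !mxE. Qed.

Lemma adjM m n p (A : 'M[C]_(m, n)) (B : 'M[C]_(n, p)) :
  (A *m B) ^t* = B ^t* *m A ^t*.
Proof. by rewrite trmx_mul map_mxM. Qed.

Lemma adjD m n (A B : 'M[C]_(m, n)) : (A + B) ^t* = A ^t* + B ^t*.
Proof. by rewrite linearD/= map_mxD. Qed.

Lemma adjB m n (A B : 'M[C]_(m, n)) : (A - B) ^t* = A ^t* - B ^t*.
Proof. by rewrite linearB/= map_mxB. Qed.

Lemma adj1 n : (1%:M : 'M[C]_n) ^t* = 1%:M.
Proof. by rewrite trmx1 map_mx1. Qed.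

Lemma adj0 m n : (0 : 'M[C]_(m, n)) ^t* = 0.
Proof. by apply/matrixP => i j; rewrite adjE !mxE conjc0. Qed.

Lemma adjZ m n (a : R) (A : 'M[C]_(m, n)) : (a%:C *: A) ^t* = a%:C *: A ^t*.
Proof. by apply/matrixP => i j; rewrite adjE !mxE rmorphM/= -conjc_real. Qed.

Lemma adj_sum I (r : seq I) (P : pred I) m n (A : I -> 'M[C]_(m, n)) :
  (\sum_(i <- r | P i) A i) ^t* = \sum_(i <- r | P i) (A i) ^t*.
Proof.
elim/big_rec2: _ => [|i y1 y2 _ <-]; first exact: adj0.
exact: adjD.
Qed.

Lemma hermsymP n (A : 'M[C]_n) : reflect (A ^t* = A) (A \is hermsymmx).
Proof.
apply: (iffP (is_hermitianmxP _ _ _)); rewrite expr0 scale1r; first by move=> <-.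
by move=> ->.
Qed.

Lemma unitary_adjl n (U : 'M[C]_n) : U \is unitarymx -> U ^t* *m U = 1%:M.
Proof. by move=> uU; apply: mulmx1C; apply/unitarymxP. Qed.

Lemma unitary_adjr n (U : 'M[C]_n) : U \is unitarymx -> U *m U ^t* = 1%:M.
Proof. by move=> uU; apply/unitarymxP. Qed.

Lemma mul_adj_unitary n (U V : 'M[C]_n) :
  U \is unitarymx -> V \is unitarymx -> U *m V ^t* \is unitarymx.
Proof.
by move=> uU uV; apply: mul_unitarymx; [exact: uU | rewrite trmxC_unitary; exact: uV].
Qed.

Definition rdiag n (a : 'I_n -> R) : 'M[C]_n := diag_mx (\row_j (a j)%:C).

Lemma rdiagE n (a : 'I_n -> R) i j : rdiag a i j = (a i)%:C *+ (i == j).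
Proof. by rewrite !mxE. Qed.

Lemma rdiag_adj n (a : 'I_n -> R) : (rdiag a) ^t* = rdiag a.
Proof.
apply/matrixP => i j; rewrite adjE !rdiagE eq_sym.
by case: eqP => [->|_]; rewrite ?mulr1n ?mulr0n ?conjc_real ?conjc0.
Qed.

Lemma mul_rdiag m n (a : 'I_m -> R) (A : 'M[C]_(m, n)) i j :
  (rdiag a *m A) i j = (a i)%:C * A i j.
Proof. by rewrite mul_diag_mx !mxE. Qed.

Lemma mul_mx_rdiag m n (a : 'I_n -> R) (A : 'M[C]_(m, n)) i j :
  (A *m rdiag a) i j = A i j * (a j)%:C.
Proof. by rewrite mul_mx_diag !mxE. Qed.

Lemma rdiagM n (a b : 'I_n -> R) :
  rdiag a *m rdiag b = rdiag (fun j => a j * b j).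
Proof.
apply/matrixP => i j; rewrite mul_rdiag !rdiagE.
by case: eqP => _; rewrite ?mulr1n ?mulr0n ?mulr0 // rmorphM.
Qed.

Lemma rdiag1 n : rdiag (fun _ : 'I_n => 1) = 1%:M.
Proof. by apply/matrixP => i j; rewrite rdiagE !mxE. Qed.

Lemma rdiagB n (a b : 'I_n -> R) :
  rdiag (fun j => a j - b j) = rdiag a - rdiag b.
Proof. by apply/matrixP => i j; rewrite !mxE rmorphB/= mulrnBl. Qed.

Lemma rdiagD n (a b : 'I_n -> R) :
  rdiag (fun j => a j + b j) = rdiag a + rdiag b.
Proof. by apply/matrixP => i j; rewrite !mxE rmorphD/= mulrnDl. Qed.

Lemma rdiagZ n c (a : 'I_n -> R) :
  rdiag (fun j => c * a j) = c%:C *: rdiag a.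
Proof. by apply/matrixP => i j; rewrite !mxE rmorphM/= mulrnAr. Qed.

Lemma rdiag_const n (c : R) : rdiag (fun _ : 'I_n => c) = c%:C%:M.
Proof. by apply/matrixP => i j; rewrite !mxE. Qed.

Lemma eq_rdiag n (a b : 'I_n -> R) : a =1 b -> rdiag a = rdiag b.
Proof. by move=> ab; apply/matrixP => i j; rewrite !rdiagE ab. Qed.

Definition fro m n (A : 'M[C]_(m, n)) : R := \sum_i \sum_j sqmod (A i j).

Lemma fro_trace m n (A : 'M[C]_(m, n)) : \tr (A ^t* *m A) = (fro A)%:C.
Proof.
rewrite /fro exchange_big/= sumC; apply: eq_bigr => j _.
by rewrite mxE sumC; apply: eq_bigr => i _; rewrite adjE sqmodC.
Qed.

Lemma fro_adj m n (A : 'M[C]_(m, n)) : fro (A ^t*) = fro A.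
Proof.
rewrite /fro exchange_big; do 2![apply: eq_bigr => ? _].
by rewrite adjE sqmodJ.
Qed.

Lemma rtrace_fro m n (A : 'M[C]_(m, n)) : rtrace (A ^t* *m A) = fro A.
Proof. by rewrite /rtrace fro_trace. Qed.

Lemma fro_unitaryl m n (U : 'M[C]_m) (A : 'M[C]_(m, n)) :
  U \is unitarymx -> fro (U *m A) = fro A.
Proof.
move=> uU; apply: complexI; rewrite -!fro_trace adjM mulmxA -(mulmxA _ _ U).
by rewrite unitary_adjl// mulmx1.
Qed.

Lemma fro_unitaryr m n (U : 'M[C]_n) (A : 'M[C]_(m, n)) :
  U \is unitarymx -> fro (A *m U) = fro A.
Proof.
move=> uU; rewrite -fro_adj adjM fro_unitaryl; first exact: fro_adj.
by rewrite trmxC_unitary.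
Qed.

Lemma froD_le m n (A B : 'M[C]_(m, n)) : fro (A + B) <= 2 * fro A + 2 * fro B.
Proof.
rewrite /fro !mulr_sumr -big_split/=; apply: ler_sum => i _.
rewrite !mulr_sumr -big_split/=; apply: ler_sum => j _.
by rewrite mxE; exact: sqmodD_le.
Qed.

Lemma rtraceC m n (A : 'M[C]_(m, n)) (B : 'M[C]_(n, m)) :
  rtrace (A *m B) = rtrace (B *m A).
Proof. by rewrite /rtrace mxtrace_mulC. Qed.

Lemma rtraceB n (A B : 'M[C]_n) : rtrace (A - B) = rtrace A - rtrace B.
Proof. by rewrite /rtrace linearB/= RecB. Qed.

Lemma rtraceZ n (a : R) (A : 'M[C]_n) : rtrace (a%:C *: A) = a * rtrace A.
Proof. by rewrite /rtrace linearZ/= RecM. Qed.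

Lemma rtrace_sum I (r : seq I) (P : pred I) n (A : I -> 'M[C]_n) :
  rtrace (\sum_(i <- r | P i) A i) = \sum_(i <- r | P i) rtrace (A i).
Proof. by rewrite /rtrace -Rec_sum; congr complex.Re; exact: raddf_sum. Qed.

Lemma rtrace_rdiag n (A : 'M[C]_n) (a : 'I_n -> R) :
  rtrace (A *m rdiag a) = \sum_i a i * complex.Re (A i i).
Proof.
rewrite /rtrace Rec_sum; apply: eq_bigr => i _.
by rewrite mul_mx_rdiag mulrC RecM.
Qed.

End Frobenius.

Section Spectral.
Context {R : realType}.
Local Notation C := R[i].

Lemma spectralP_herm n (A : 'M[C]_n) : A \is hermsymmx ->
  let P := spectralmx A in
  P \is unitarymx /\ A = P ^t* *m
    rdiag (fun j => complex.Re (spectral_diag A 0 j)) *m P.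
Proof.
move=> hA P; split; first exact: spectral_unitarymx.
have e : diag_mx (spectral_diag A) = rdiag (fun j => complex.Re (spectral_diag A 0 j)).
  apply/matrixP => i j; rewrite !mxE RRe_real//.
  by have /mxOverP := hermitian_spectral_diag_real hA; exact.
have := orthomx_spectralP (hermitian_normalmx hA).
by rewrite invmx_unitary ?spectral_unitarymx// -/P e.
Qed.

Lemma herm_diagonalize n (A : 'M[C]_n) : A \is hermsymmx ->
  exists (P : 'M[C]_n) (a : 'I_n -> R), P \is unitarymx /\ A = P ^t* *m rdiag a *m P.
Proof. by move=> /spectralP_herm[uP eA]; exists (spectralmx A); eexists; split; last exact: eA. Qed.

Lemma conj_rdiag_herm n (P : 'M[C]_n) (a : 'I_n -> R) : P ^t* *m rdiag a *m P \is hermsymmx.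
Proof. by apply/hermsymP; rewrite !adjM rdiag_adj trmxCK mulmxA. Qed.

Lemma conj_rdiag_fun n (P S : 'M[C]_n) (a b : 'I_n -> R) (f : R -> R) :
  P \is unitarymx -> S \is unitarymx ->
  P ^t* *m rdiag a *m P = S ^t* *m rdiag b *m S ->
  P ^t* *m rdiag (f \o a) *m P = S ^t* *m rdiag (f \o b) *m S.
Proof.
move=> uP uS eA.
have eW : (S *m P ^t*) *m rdiag a = rdiag b *m (S *m P ^t*).
  have := congr1 (fun X => S *m X *m P ^t*) eA.
  by rewrite !mulmxA (unitary_adjr uS) mul1mx -(mulmxA _ P) (unitary_adjr uP) mulmx1.
have eW' : (S *m P ^t*) *m rdiag (f \o a) = rdiag (f \o b) *m (S *m P ^t*).
  apply/matrixP => i j; have /matrixP/(_ i j) := eW.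
  rewrite !mul_rdiag !mul_mx_rdiag => /eqP.
  rewrite mulrC -subr_eq0 -mulrBl mulf_eq0 => /orP[|/eqP->]; last by rewrite mul0r mulr0.
  rewrite -rmorphB/= => /eqP/complexI/eqP; rewrite subr_eq0 /= => /eqP->.
  by rewrite mulrC.
have := congr1 (fun X => S ^t* *m X *m P) eW'.
by rewrite /= !mulmxA (unitary_adjl uS) mul1mx -!mulmxA (unitary_adjl uP) mulmx1 !mulmxA.
Qed.

Lemma herm_calcE n (P : 'M[C]_n) (a : 'I_n -> R) (f : R -> R) :
  P \is unitarymx ->
  herm_calc f (P ^t* *m rdiag a *m P) = P ^t* *m rdiag (f \o a) *m P.
Proof.
move=> uP; have [uS eA] := spectralP_herm (conj_rdiag_herm P a).
rewrite /herm_calc (invmx_unitary uS).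
move: uS eA; move: (spectralmx _) (spectral_diag _) => S b uS eA.
rewrite [RHS](conj_rdiag_fun f uP uS eA).
set F := diag_mx _; have -> // : F = rdiag (f \o (fun j => complex.Re (b 0 j))).
by apply/matrixP => i j; rewrite !mxE.
Qed.

Lemma lnmx_shift n (P : 'M[C]_n) (a : 'I_n -> R) (e : R) : P \is unitarymx ->
  lnmx (P ^t* *m rdiag a *m P + (e%:C)%:M) =
  P ^t* *m rdiag (fun x => ln (a x + e)) *m P.
Proof.
move=> uP; rewrite -(mulmx1 (_%:M)) -(unitary_adjl uP) mulmxA -scalar_mxC.
by rewrite -mulmxDl -rdiag_const -mulmxDr -rdiagD /lnmx herm_calcE.
Qed.

Lemma quad_rdiag n (P : 'M[C]_n) (a : 'I_n -> R) (u : 'cV[C]_n) :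
  (u ^t* *m (P ^t* *m rdiag a *m P) *m u) 0 0 =
  (\sum_x a x * sqmod ((P *m u) x 0))%:C.
Proof.
rewrite -!mulmxA (mulmxA (u ^t*)) -adjM mxE sumC; apply: eq_bigr => x _.
by rewrite mul_rdiag adjE rmorphM/= sqmodC mulrCA.
Qed.

Lemma psdmx_rdiag n (P : 'M[C]_n) (a : 'I_n -> R) : P \is unitarymx ->
  psdmx (P ^t* *m rdiag a *m P) <-> forall x, 0 <= a x.
Proof.
move=> uP; split=> [[_ h] x|a0]; last first.
  split; first exact: conj_rdiag_herm.
  move=> u; rewrite quad_rdiag lecR; apply: sumr_ge0 => x _.
  by rewrite mulr_ge0// sqmod_ge0.
have := h (P ^t* *m delta_mx x 0); rewrite quad_rdiag lecR.
rewrite mulmxA unitary_adjr// mul1mx (bigD1 x)//= big1 => [|y yx].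
  by rewrite mxE !eqxx addr0 sqmod1 mulr1.
by rewrite mxE (negbTE yx) sqmod0 mulr0.
Qed.

Lemma psd_factor n (A : 'M[C]_n) : psdmx A -> exists B : 'M[C]_n, A = B *m B ^t*.
Proof.
move=> pA; have [P [a [uP eA]]] := herm_diagonalize pA.1.
rewrite eA in pA *; have a0 := (psdmx_rdiag _ uP).1 pA.
exists (P ^t* *m rdiag (Num.sqrt \o a)); rewrite adjM rdiag_adj trmxCK.
rewrite mulmxA -(mulmxA _ (rdiag _) (rdiag _)) rdiagM; congr (_ *m _ *m _).
by apply: eq_rdiag => x /=; rewrite -expr2 sqr_sqrtr.
Qed.

Lemma psd_gram m n (A : 'M[C]_(m, n)) : psdmx (A ^t* *m A).
Proof.
split; first by apply/hermsymP; rewrite adjM trmxCK.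
move=> u; rewrite mulmxA -mulmxA -adjM.
rewrite mxE; apply: sumr_ge0 => i _; rewrite adjE -sqmodC lecR; exact: sqmod_ge0.
Qed.

Lemma psdD n (A B : 'M[C]_n) : psdmx A -> psdmx B -> psdmx (A + B).
Proof.
move=> [hA pA] [hB pB]; split.
  by apply/hermsymP; rewrite adjD (hermsymP _ hA) (hermsymP _ hB).
by move=> u; rewrite mulmxDr mulmxDl mxE addr_ge0.
Qed.

Lemma psd0 n : psdmx (0 : 'M[C]_n).
Proof.
split; first by apply/hermsymP; exact: adj0.
by move=> u; rewrite mulmx0 mul0mx mxE.
Qed.

Lemma psd_sum I (r : seq I) (P : pred I) n (A : I -> 'M[C]_n) :
  (forall i, P i -> psdmx (A i)) -> psdmx (\sum_(i <- r | P i) A i).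
Proof. by move=> h; elim/big_rec: _ => [|i x /h]; [exact: psd0|exact: psdD]. Qed.

Lemma psdZ n (c : R) (A : 'M[C]_n) : 0 <= c -> psdmx A -> psdmx (c%:C *: A).
Proof.
move=> c0 [hA pA]; split.
  by apply/hermsymP; rewrite adjZ (hermsymP _ hA).
by move=> u; rewrite -scalemxAr -scalemxAl mxE mulr_ge0 ?ler0c.
Qed.

Lemma psd_conj n m (A : 'M[C]_n) (U : 'M[C]_(n, m)) :
  psdmx A -> psdmx (U ^t* *m A *m U).
Proof.
move=> /psd_factor[B ->]; rewrite mulmxA -mulmxA.
by have := psd_gram (B ^t* *m U); rewrite adjM trmxCK.
Qed.

End Spectral.

(** * Tensor powers in coordinates *)

Section Digits.
Context {D : nat}.

Fixpoint dig_rec (n : nat) : 'I_(D ^ n.+1) -> 'I_n.+1 -> 'I_D :=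
  match n with
  | 0 => fun x _ => x
  | n'.+1 => fun x j =>
      if unlift ord0 j is Some j' then dig_rec (mxtens_unindex x).2 j'
      else (mxtens_unindex x).1
  end.

(* The j-th letter of the word that the index x of a tensor power encodes. *)
Definition dig (n : nat) : 'I_(D ^ n) -> 'I_n -> 'I_D :=
  match n with
  | 0 => fun _ j => False_rect _ (notF (ltn_ord j))
  | n'.+1 => @dig_rec n'
  end.

Lemma dig_rec_inj n (x y : 'I_(D ^ n.+1)) : dig_rec x =1 dig_rec y -> x = y.
Proof.
elim: n x y => [|n IH] x y exy; first exact: (exy ord0).
rewrite -[x](@mxtens_unindexK D (D ^ n.+1)) -[y](@mxtens_unindexK D (D ^ n.+1)).
congr mxtens_index.
rewrite [LHS]surjective_pairing [RHS]surjective_pairing; congr (_, _).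
  by have := exy ord0; rewrite /= unlift_none.
by apply: IH => j; have := exy (lift ord0 j); rewrite /= liftK.
Qed.

Lemma dig_inj n (x y : 'I_(D ^ n)) : dig x =1 dig y -> x = y.
Proof.
case: n x y => [x y _|n x y]; last exact: dig_rec_inj.
exact: etrans (ord1 (x : 'I_1)) (esym (ord1 (y : 'I_1))).
Qed.

Lemma dig_bij n : bijective (fun x : 'I_(D ^ n) => [ffun j => dig x j]).
Proof.
apply: inj_card_bij => [x y /ffunP exy|]; last by rewrite card_ffun !card_ord.
by apply: dig_inj => j; have := exy j; rewrite !ffunE.
Qed.

(** Distributivity over words; it reduces traces and expectations on the tensor power to one
    site. *)
Lemma sum_prod_dig (K : comNzRingType) n (a : 'I_n -> 'I_D -> K) :
  \sum_x \prod_j a j (dig x j) = \prod_j \sum_k a j k.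
Proof.
rewrite bigA_distr_bigA/= (reindex _ (onW_bij _ (dig_bij n)))/=.
by apply: eq_bigr => x _; apply: eq_bigr => j _; rewrite ffunE.
Qed.

Lemma sum2_prod_dig (K : comNzRingType) n (a : 'I_n -> 'I_D -> 'I_D -> K) :
  \sum_x \sum_y \prod_j a j (dig x j) (dig y j) = \prod_j \sum_k \sum_l a j k l.
Proof.
rewrite -(sum_prod_dig (fun j k => \sum_l a j k l)); apply: eq_bigr => x _.
by rewrite -(sum_prod_dig (fun j l => a j (dig x j) l)).
Qed.

End Digits.

Section BigTensor.
Context {R : realType} {D : nat}.
Local Notation C := R[i].

Lemma bigtensE (K : comNzRingType) n (A : 'I_n -> 'M[K]_D) x y :
  bigtens A x y = \prod_j A j (dig x j) (dig y j).
Proof.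
case: n A x y => [|n] A x y.
  rewrite big_ord0 /bigtens (etrans (ord1 (x : 'I_1)) (esym (ord1 (y : 'I_1)))).
  by rewrite mxE eqxx.
rewrite /bigtens /dig; elim: n A x y => [|n IH] A x y.
  by rewrite big_ord1.
rewrite big_ord_recl/= mxE IH unlift_none; congr (_ * _).
by apply: eq_bigr => j _; rewrite liftK.
Qed.

Lemma bigtensM (K : comNzRingType) n (A B : 'I_n -> 'M[K]_D) :
  bigtens A *m bigtens B = bigtens (fun j => A j *m B j).
Proof.
apply/matrixP => x y; rewrite !mxE bigtensE.
under [RHS]eq_bigr do rewrite mxE.
rewrite -(sum_prod_dig (fun j k => A j (dig x j) k * B j k (dig y j))).
by apply: eq_bigr => z _; rewrite !bigtensE big_split.
Qed.

Lemma bigtens1 (K : comNzRingType) n : bigtens (fun _ : 'I_n => 1%:M : 'M[K]_D) = 1%:M.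
Proof.
apply/matrixP => x y; rewrite bigtensE !mxE.
under eq_bigr do rewrite mxE.
case: eqVneq => [->|xy]; first by rewrite big1// => j _; rewrite eqxx.
have /existsP[j jxy] : [exists j, dig x j != dig y j].
  apply: contraNT xy; rewrite negb_exists => /forallP h.
  by apply/eqP/dig_inj => j; apply/eqP; rewrite -[_ == _]negbK.
by rewrite (bigD1 j)//= (negbTE jxy) mul0r.
Qed.

Lemma bigtens_adj n (A : 'I_n -> 'M[C]_D) :
  (bigtens A) ^t* = bigtens (fun j => (A j) ^t*).
Proof.
apply/matrixP => x y; rewrite adjE !bigtensE rmorph_prod.
by apply: eq_bigr => j _; rewrite adjE.
Qed.

Lemma eq_bigtens (K : comNzRingType) n (A B : 'I_n -> 'M[K]_D) :
  A =1 B -> bigtens A = bigtens B.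
Proof. by move=> AB; apply/matrixP => x y; rewrite !bigtensE; apply: eq_bigr => j _; rewrite AB. Qed.

Lemma bigtens_rdiag n (a : 'I_n -> 'I_D -> R) :
  bigtens (fun j => rdiag (a j)) = rdiag (fun x => \prod_j a j (dig x j)).
Proof.
apply/matrixP => x y; rewrite bigtensE rdiagE.
under eq_bigr do rewrite rdiagE.
have := bigtens1 C n => /matrixP/(_ x y); rewrite bigtensE !mxE.
under eq_bigr do rewrite mxE.
have -> : \prod_j ((a j (dig x j))%:C *+ (dig x j == dig y j)) =
  (\prod_j a j (dig x j))%:C * \prod_j (dig x j == dig y j)%:R.
  by rewrite prodC -big_split/=; apply: eq_bigr => j _; rewrite mulr_natr.
by move=> ->; rewrite mulr_natr.
Qed.

Lemma trace_bigtens (K : comNzRingType) n (A : 'I_n -> 'M[K]_D) :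
  \tr (bigtens A) = \prod_j \tr (A j).
Proof.
rewrite -(sum_prod_dig (fun j k => A j k k)).
by apply: eq_bigr => x _; rewrite bigtensE.
Qed.

Lemma bigtens_unitary n (U : 'I_n -> 'M[C]_D) :
  (forall j, U j \is unitarymx) -> bigtens U \is unitarymx.
Proof.
move=> uU; apply/unitarymxP; rewrite bigtens_adj bigtensM -(bigtens1 C n).
by apply: eq_bigtens => j; exact: unitary_adjr.
Qed.

Definition onsite n (j : 'I_n) (A : 'M[C]_D) : 'M[C]_(D ^ n) :=
  bigtens (fun i => if i == j then A else 1%:M).

Lemma onsite_entry n (j : 'I_n) A x y :
  onsite j A x y = \prod_i (if i == j then A else 1%:M) (dig x i) (dig y i).
Proof. by rewrite /onsite bigtensE. Qed.

Definition sitesum n (A : 'M[C]_D) : 'M[C]_(D ^ n) := \sum_j onsite j A.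

Lemma onsiteB n (j : 'I_n) A B : onsite j (A - B) = onsite j A - onsite j B.
Proof.
apply/matrixP => x y; rewrite !mxE !onsite_entry (bigD1 j)//=.
rewrite [X in _ = X - _](bigD1 j)//= [X in _ = _ - X](bigD1 j)//= !eqxx !mxE.
rewrite mulrBl; congr (_ * _ - _ * _); apply: eq_bigr => i /negbTE->//.
Qed.

Lemma sitesumB n A B : sitesum n (A - B) = sitesum n A - sitesum n B.
Proof. by rewrite /sitesum -sumrB; apply: eq_bigr => j _; exact: onsiteB. Qed.

Lemma sitesum_rdiag n (a : 'I_D -> R) :
  sitesum n (rdiag a) = rdiag (fun x => \sum_j a (dig x j)).
Proof.
apply/matrixP => x y; rewrite /sitesum summxE rdiagE sumC -sumrMnl.
apply: eq_bigr => j _.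
have -> : onsite j (rdiag a) = rdiag (fun x => a (dig x j)); last by rewrite rdiagE.
rewrite /onsite (eq_bigtens (B := fun i => rdiag (if i == j then a else fun=> 1))).
  rewrite bigtens_rdiag; apply: eq_rdiag => z.
  by rewrite (bigD1 j)//= eqxx big1 ?mulr1// => i /negbTE->.
by move=> i; case: eqP => // _; rewrite rdiag1.
Qed.

Lemma sitesum_conj n (W : 'M[C]_D) A : W \is unitarymx ->
  sitesum n (W ^t* *m A *m W) =
  (bigtens (fun _ : 'I_n => W)) ^t* *m sitesum n A *m bigtens (fun=> W).
Proof.
move=> uW; rewrite /sitesum mulmx_sumr mulmx_suml; apply: eq_bigr => j _.
rewrite bigtens_adj /onsite !bigtensM; apply: eq_bigtens => i.
by case: eqP => // _; rewrite mulmx1 unitary_adjl.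
Qed.

Lemma onsite_adj n (j : 'I_n) A : (onsite j A) ^t* = onsite j (A ^t*).
Proof.
rewrite /onsite bigtens_adj; apply: eq_bigtens => i.
by case: eqP => // _; rewrite adj1.
Qed.

Lemma sitesum_adj n A : (sitesum n A) ^t* = sitesum n (A ^t*).
Proof. by rewrite /sitesum adj_sum; apply: eq_bigr => j _; exact: onsite_adj. Qed.

Lemma onsiteM n (j k : 'I_n) A B : onsite j A *m onsite k B =
  bigtens (fun i => (if i == j then A else 1%:M) *m (if i == k then B else 1%:M)).
Proof. by rewrite /onsite bigtensM. Qed.

End BigTensor.

(** Writing a product state as B times its adjoint turns error probabilities into Frobenius
    norms. *)
Lemma psd_bigtens (R : realType) D n (A : 'I_n -> 'M[R[i]]_D) :
  (forall j, psdmx (A j)) -> exists2 B : 'I_n -> 'M[R[i]]_D,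
    forall j, A j = B j *m (B j) ^t* & bigtens A = bigtens B *m (bigtens B) ^t*.
Proof.
move=> pA; have [B hB] := choice (fun j => psd_factor (pA j)).
exists B; first exact: hB.
by rewrite bigtens_adj bigtensM; apply: eq_bigtens; exact: hB.
Qed.

(** Truncated subtraction covers the empty interval, which occurs when two windows do not
    overlap. *)
Lemma sum_window (N a b : nat) :
  (\sum_(v < N) ((a < v <= b) : nat) = minn N b.+1 - a.+1)%N.
Proof.
elim: N => [|N IH]; first by rewrite big_ord0; lia.
by rewrite big_ord_recr/= IH; case: (leqP a.+1 N) => ?; case: (leqP N b) => ? /=; lia.
Qed.

(** * Entrywise bounds for unitary and density matrices *)

Section MatrixBounds.
Context {R : realType}.
Local Notation C := R[i].

Lemma fro_rdiagE m n (a : 'I_m -> R) (A : 'M[C]_(m, n)) :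
  fro (rdiag a *m A) = \sum_i a i ^+ 2 * \sum_j sqmod (A i j).
Proof.
apply: eq_bigr => i _; rewrite mulr_sumr; apply: eq_bigr => j _.
by rewrite mul_rdiag sqmodM sqmod_real.
Qed.

Lemma fro_rdiag_mono m n (a b : 'I_m -> R) (A : 'M[C]_(m, n)) :
  (forall i, a i ^+ 2 <= b i ^+ 2) -> fro (rdiag a *m A) <= fro (rdiag b *m A).
Proof.
move=> ab; rewrite !fro_rdiagE; apply: ler_sum => i _.
by rewrite ler_wpM2r// sumr_ge0// => j _; exact: sqmod_ge0.
Qed.

Lemma unitary_rowsum n (U : 'M[C]_n) i : U \is unitarymx -> \sum_j sqmod (U i j) = 1.
Proof.
move=> /unitary_adjr/matrixP/(_ i i); rewrite !mxE eqxx => h.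
apply: complexI; rewrite -[RHS]/(1 : C) -[RHS]h sumC; apply: eq_bigr => j _.
by rewrite adjE sqmodC mulrC.
Qed.

Lemma unitary_colsum n (U : 'M[C]_n) j : U \is unitarymx -> \sum_i sqmod (U i j) = 1.
Proof.
rewrite -trmxC_unitary => /unitary_rowsum-/(_ j) <-; apply: eq_bigr => i _.
by rewrite adjE sqmodJ.
Qed.

Lemma unitary_sqmod_le1 n (U : 'M[C]_n) i j : U \is unitarymx -> sqmod (U i j) <= 1.
Proof.
move=> uU; rewrite -(unitary_rowsum i uU) (bigD1 j)//= lerDl.
by apply: sumr_ge0 => k _; exact: sqmod_ge0.
Qed.

Lemma density_diag n (A : 'M[C]_n) : density A ->
  exists (P : 'M[C]_n) (a : 'I_n -> R), [/\ P \is unitarymx,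
    A = P ^t* *m rdiag a *m P, forall x, 0 <= a x & \sum_x a x = 1].
Proof.
move=> [pA tA]; have [P [a [uP eA]]] := herm_diagonalize pA.1.
exists P, a; split => //; first by apply/(psdmx_rdiag _ uP); rewrite -eA.
apply: complexI; rewrite -[RHS]/(1 : C) -tA eA -mulmxA mxtrace_mulC -mulmxA.
rewrite (unitary_adjr uP) mulmx1 sumC /mxtrace; apply: eq_bigr => i _.
by rewrite rdiagE eqxx.
Qed.

Lemma density_entry_le1 n (A : 'M[C]_n) k l : density A -> normc (A k l) <= 1.
Proof.
move=> /density_diag[P [a [uP -> a0 a1]]]; rewrite -mulmxA mxE.
apply: (le_trans (normc_sum _ _ _)); rewrite -a1; apply: ler_sum => x _.
rewrite adjE mul_rdiag !normcM normc_real// mulrCA ler_piMr//.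
rewrite -[leRHS]mulr1 ler_pM ?normc_ge0 ?normc_sqmod//.
  by rewrite sqmodJ -sqrtr1 ler_sqrt// unitary_sqmod_le1.
by rewrite -sqrtr1 ler_sqrt// unitary_sqmod_le1.
Qed.

Lemma density_normc_diag n (A : 'M[C]_n) : density A -> \sum_k normc (A k k) = 1.
Proof.
move=> dA; apply: complexI; rewrite -[RHS]/(1 : C) -dA.2 sumC /mxtrace; apply: eq_bigr => k _.
have [B eB] := psd_factor dA.1.
have -> : A k k = (\sum_j sqmod (B k j))%:C.
  by rewrite eB mxE sumC; apply: eq_bigr => j _; rewrite adjE sqmodC mulrC.
by rewrite normc_real// sumr_ge0// => j _; exact: sqmod_ge0.
Qed.

Lemma trace_sum2 n (A B : 'M[C]_n) : \tr (A *m B) = \sum_x \sum_y A x y * B y x.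
Proof. by apply: eq_bigr => x _; rewrite mxE. Qed.

Lemma rtrace_le_normc n (A B : 'M[C]_n) :
  normc (\tr (A *m B)) <= \sum_x \sum_y normc (A x y) * normc (B y x).
Proof.
rewrite trace_sum2; apply: (le_trans (normc_sum _ _ _)).
apply: ler_sum => x _; apply: (le_trans (normc_sum _ _ _)).
by apply: ler_sum => y _; rewrite normcM.
Qed.

(** An entrywise norm is used because the windows weight the entries of a matrix individually;
    moduli of entries are still multiplicative over the sites. *)
Definition norm1 n (A : 'M[C]_n) : R := \sum_x \sum_y normc (A x y).

Lemma norm1_ge0 n (A : 'M[C]_n) : 0 <= norm1 A.
Proof. by do 2![apply: sumr_ge0 => ? _]; exact: normc_ge0. Qed.

Lemma sum_normc_density n (A B : 'M[C]_n) : density B ->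
  \sum_x \sum_y normc (A x y) * normc (B y x) <= norm1 A.
Proof.
move=> dB; apply: ler_sum => x _; apply: ler_sum => y _.
by rewrite ler_piMr ?normc_ge0// density_entry_le1.
Qed.

(** A site where the identity acts contributes exactly 1. A larger constant would grow exponentially
    over the n sites. *)
Lemma sum_normc_density1 n (B : 'M[C]_n) : density B ->
  \sum_x \sum_y normc ((1%:M : 'M[C]_n) x y) * normc (B y x) = 1.
Proof.
move=> dB; rewrite -(density_normc_diag dB); apply: eq_bigr => x _.
rewrite (bigD1 x)//= big1 ?mxE ?eqxx ?normc1 ?mul1r ?addr0//.
by move=> y; rewrite eq_sym mxE => /negbTE->; rewrite normc0 mul0r.
Qed.

End MatrixBounds.

(** * The window test *)

Section WindowTest.
Context {R : realType} {D : nat} (n m : nat) (lam kap : 'I_D -> R)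
  (Lam Delta : R) (W : 'M[R[i]]_D).
Local Notation C := R[i].
Context (lam_ge0 : forall x, 0 <= lam x) (lam_le : forall x, lam x <= Lam)
  (uW : W \is unitarymx) (Lam_ge0 : 0 <= Lam) (m_gt0 : (0 < m)%N) (Delta_gt0 : 0 < Delta).

Definition wsum (a : 'I_D -> R) (x : 'I_(D ^ n)) : R := \sum_j a (dig x j).

(* The integer part of the eigenvalue of L at the product eigenvector x; it lies
   in the window from v - m to v - 1 for exactly [m] values of v. *)
Definition level (x : 'I_(D ^ n)) : nat := Num.trunc (wsum lam x).

(** The successor makes the last window, v = level + m, available for every x. *)
Definition nwin : nat := (\max_x level x + m).+1.

Definition win (v : nat) (x : 'I_(D ^ n)) : bool := (level x < v <= level x + m)%N.

(** Lower end of the window: if [win v x] holds, the eigenvalue of L at x lies between [low v] and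
    [low v + m]. The difference is taken in R because it may be negative. *)
Definition low (v : nat) : R := v%:R - m%:R.

Definition keep (v : nat) (y : 'I_(D ^ n)) : bool := low v - Delta <= wsum kap y.

Definition Wn : 'M[C]_(D ^ n) := bigtens (fun=> W).

Definition Fw v : 'M[C]_(D ^ n) := rdiag (fun x => (win v x)%:R).

Definition Gw v := rdiag (fun y => (keep v y)%:R) *m Wn *m Fw v.

Definition Hw v := rdiag (fun y => (~~ keep v y)%:R) *m Wn *m Fw v.

(* A coarse measurement of L followed by the test that K is not much smaller.
   Averaging over the [m] offsets of the windows replaces a sharp cut in the
   spectrum of L, which would disturb K too much. *)
Definition wtest : 'M[C]_(D ^ n) :=
  (m%:R^-1)%:C *: \sum_(v < nwin) ((Gw v) ^t* *m Gw v).

Definition tdiff : 'M[C]_D := W ^t* *m rdiag kap *m W - rdiag lam.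

Lemma Wn_unitary : Wn \is unitarymx. Proof. exact: bigtens_unitary. Qed.

Lemma mR_gt0 : 0 < m%:R :> R. Proof. by rewrite ltr0n. Qed.

Lemma wsum_ge0 x : 0 <= wsum lam x.
Proof. exact: sumr_ge0. Qed.

Lemma level_le x : (level x)%:R <= wsum lam x.
Proof. by have /andP[] := truncn_itv (wsum_ge0 x). Qed.

Lemma level_gt x : wsum lam x < (level x)%:R + 1.
Proof. by have /andP[_] := truncn_itv (wsum_ge0 x); rewrite -natr1. Qed.

Lemma level_nwin x : (level x + m < nwin)%N.
Proof. by rewrite /nwin ltnS leq_add2r; exact: leq_bigmax. Qed.

Lemma sum_win x : (\sum_(v < nwin) (win v x : nat) = m)%N.
Proof. by rewrite sum_window; have := level_nwin x; lia. Qed.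

Lemma sum_winR x : \sum_(v < nwin) (win v x)%:R = m%:R :> R.
Proof. by rewrite -natr_sum sum_win. Qed.

(** The common windows of x and x' form an interval of length m minus the distance of the levels, or
    are absent; the two truncated differences add up to that distance. *)
Lemma sum_win2 x x' : (m - \sum_(v < nwin) ((win v x && win v x') : nat)
  <= (level x - level x') + (level x' - level x))%N.
Proof.
rewrite (eq_bigr (fun v : 'I_nwin => (maxn (level x) (level x') < v <=
  minn (level x) (level x') + m)%N : nat)); last first.
  move=> v _; rewrite /win; congr (nat_of_bool _).
  rewrite gtn_max addn_minl leq_min.
  by case: (level x < v)%N; case: (level x' < v)%N; rewrite /= ?andbF ?andbT.
by rewrite sum_window; have := level_nwin x; have := level_nwin x'; lia.
Qed.

Definition cnt x x' : R := \sum_(v < nwin) (win v x && win v x')%:R.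

Lemma cnt_le x x' : cnt x x' <= m%:R.
Proof.
rewrite -(sum_winR x); apply: ler_sum => v _.
by rewrite ler_nat; case: (win v x); case: (win v x').
Qed.

(** The additional 1 pays for the rounding in [level]. *)
Lemma cnt_ge x x' : m%:R - cnt x x' <= `|wsum lam x - wsum lam x'| + 1.
Proof.
have := sum_win2 x x'; rewrite leq_subLR -(ler_nat R) natrD natr_sum -/(cnt x x').
have := level_le x; have := level_le x'; have := level_gt x; have := level_gt x'.
case/orP: (leq_total (level x) (level x')) => l h1 h2 h3 h4;
  rewrite (eqP l) ?add0n ?addn0 natrB//.
  by have := ler_norm (- (wsum lam x - wsum lam x')); rewrite normrN; lra.
by have := ler_norm (wsum lam x - wsum lam x'); lra.
Qed.

Lemma sum_Fw : \sum_(v < nwin) (Fw v ^t* *m Fw v) = (m%:R)%:C *: 1%:M.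
Proof.
transitivity (rdiag (fun x => \sum_(v < nwin) ((win v x)%:R : R)) : 'M[C]_(D ^ n)).
  apply/matrixP => x y; rewrite summxE rdiagE sumC -sumrMnl; apply: eq_bigr => v _.
  by rewrite rdiag_adj rdiagM rdiagE; case: win; rewrite ?mulr1 ?mulr0.
rewrite (eq_rdiag (b := fun=> m%:R)) => [|x]; last exact: sum_winR.
by rewrite rdiag_const scalemx1.
Qed.

Lemma GHw v : (Gw v) ^t* *m Gw v + (Hw v) ^t* *m Hw v = Fw v ^t* *m Fw v.
Proof.
have key (b : 'I_(D ^ n) -> bool) (X : 'M[C]_(D ^ n)) :
    (rdiag (fun y => (b y)%:R) *m X) ^t* *m
    (rdiag (fun y => (b y)%:R) *m X) = X ^t* *m rdiag (fun y => (b y)%:R : R) *m X.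
  rewrite adjM rdiag_adj -!mulmxA (mulmxA (rdiag _) (rdiag _)) rdiagM.
  rewrite (eq_rdiag (b := fun y => (b y)%:R : R)) => [//|y].
  by case: (b y); rewrite ?mulr1 ?mulr0.
rewrite /Gw /Hw -!(mulmxA _ Wn) !key -mulmxDl -mulmxDr -rdiagD.
rewrite (eq_rdiag (b := fun=> 1)) => [|y]; last by case: keep; rewrite ?addr0 ?add0r.
by rewrite rdiag1 mulmx1 adjM mulmxA -(mulmxA _ _ Wn) (unitary_adjl Wn_unitary) mulmx1.
Qed.

Lemma wtestC : 1%:M - wtest = (m%:R^-1)%:C *: \sum_(v < nwin) ((Hw v) ^t* *m Hw v).
Proof.
apply/eqP; rewrite subr_eq /wtest -scalerDr -big_split/=.
under eq_bigr do rewrite addrC GHw.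
rewrite sum_Fw scalerA -rmorphM/= mulVf ?gt_eqF ?mR_gt0//.
by rewrite scale1r.
Qed.

Lemma wtest_is_test : is_test wtest.
Proof.
split; rewrite /loewner_le; last first.
  rewrite wtestC; apply: psdZ; first by rewrite invr_ge0 ltW// mR_gt0.
  by apply: psd_sum => v _; exact: psd_gram.
rewrite subr0 /wtest; apply: psdZ; first by rewrite invr_ge0 ltW// mR_gt0.
by apply: psd_sum => v _; exact: psd_gram.
Qed.

(** A window v of x satisfies v >= level + 1 > [wsum lam x], so y kept in it satisfies a condition
    that no longer involves v; the m windows of x cancel the factor 1/m. Diagonal entries suffice
    since the alternative is diagonal in the eigenbasis of L. *)
Lemma wtest_diag x : complex.Re (wtest x x) <=
  \sum_y (wsum lam x - m%:R - Delta <= wsum kap y)%R%:R * sqmod (Wn y x).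
Proof.
rewrite mxE RecM summxE Rec_sum ler_pdivrMl ?mR_gt0//.
rewrite -[X in _ <= X * _](sum_winR x) mulr_suml; apply: ler_sum => v _.
have -> : complex.Re (((Gw v) ^t* *m Gw v) x x) = \sum_y sqmod (Gw v y x).
  by rewrite mxE Rec_sum; apply: eq_bigr => y _; rewrite adjE Re_mulJ.
rewrite mulr_sumr; apply: ler_sum => y _.
rewrite /Gw mul_mx_rdiag mul_rdiag !sqmodM !sqmod_real.
have [/andP[wl wr]|] := boolP (win v x); last first.
  by move=> _; rewrite expr0n/= mulr0 mul0r.
rewrite expr1n mulr1 mul1r ler_wpM2r ?sqmod_ge0// -natrX ler_nat.
case: (boolP (keep v y)) => //; rewrite /keep /low => k.
rewrite exp1n lt0b; apply: le_trans k; rewrite lerD2r lerD2r.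
apply: (le_trans (ltW (level_gt x))); rewrite natr1 ler_nat//.
Qed.

(* On the range of a window L - low is at most [m], so
   (K - low) F = (L - low) F + (K - L) F is small, while a rejected eigenvector
   of K has |K - low| > Delta. *)
Lemma fro_Hw_le v (B : 'M[C]_(D ^ n)) : fro (Hw v *m B) <=
  Delta ^- 2 * (2 * (m%:R ^+ 2 * fro (Fw v *m B)) +
    2 * fro (sitesum n tdiff *m (Fw v *m B))).
Proof.
rewrite /Hw -!mulmxA.
apply: (@le_trans _ _ (fro (rdiag (fun y => Delta^-1 * (wsum kap y - low v)) *m
    (Wn *m (Fw v *m B))))).
  apply: fro_rdiag_mono => y; rewrite exprMn exprVn.
  have D2 : 0 < Delta ^+ 2 by rewrite exprn_gt0.
  case: (boolP (keep v y)); rewrite /keep -?ltNge => k.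
    by rewrite expr0n/= mulr_ge0 ?sqr_ge0 ?invr_ge0 ?ltW.
  rewrite /= expr1n -(ler_pM2l D2) mulrA mulfV ?gt_eqF// mul1r mulr1.
  rewrite -subr_ge0 (_ : _ - _ = (low v - wsum kap y - Delta) *
    (low v - wsum kap y + Delta)); last by ring.
  by move: Delta_gt0 k => d0 k; apply: mulr_ge0; lra.
have -> : rdiag (fun y => Delta^-1 * (wsum kap y - low v)) *m (Wn *m (Fw v *m B))
  = (Delta^-1)%:C *: (Wn *m (rdiag (fun x => wsum lam x - low v) *m (Fw v *m B)
      + sitesum n tdiff *m (Fw v *m B))).
  rewrite rdiagZ -scalemxAl; congr (_ *: _).
  rewrite -mulmxDl !mulmxA; congr (_ *m _ *m _).
  rewrite !rdiagB !rdiag_const /tdiff sitesumB sitesum_conj// !sitesum_rdiag.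
  rewrite -/Wn -[rdiag (fun x => \sum_j lam _)]/(rdiag (wsum lam)).
  rewrite -[rdiag (fun x => \sum_j kap _)]/(rdiag (wsum kap)) [X in Wn *m X]addrC subrKA.
  rewrite -raddfB/= mulmxBr !mulmxA (unitary_adjr Wn_unitary) mul1mx.
  by rewrite mulmxBl scalar_mxC.
have -> A : fro ((Delta^-1)%:C *: A) = Delta ^- 2 * fro A.
  rewrite /fro mulr_sumr; apply: eq_bigr => i _; rewrite mulr_sumr.
  by apply: eq_bigr => j _; rewrite mxE sqmodM sqmod_real exprVn.
rewrite ler_wpM2l ?invr_ge0 ?sqr_ge0// fro_unitaryl ?Wn_unitary//.
apply: (le_trans (froD_le _ _)); rewrite lerD2r ler_wpM2l//.
rewrite mulmxA rdiagM !fro_rdiagE mulr_sumr; apply: ler_sum => x _.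
rewrite mulrA ler_wpM2r//; first by apply: sumr_ge0 => j _; exact: sqmod_ge0.
case: (boolP (win v x)) => [/andP[wl wr]|_]; last by rewrite mulr0 !expr0n/= mulr0.
rewrite expr1n !mulr1 /low.
have h1 := level_le x; have h2 := level_gt x.
have : (level x)%:R + 1 <= v%:R :> R by rewrite natr1 ler_nat.
have : v%:R <= (level x)%:R + m%:R :> R by rewrite -natrD ler_nat.
by have := mR_gt0; nra.
Qed.


(** Expands Tr (T^2 F sigma F) in coordinates, so that summing over v turns the two window
    indicators into [cnt]. *)
Lemma fro_sandwich (T B sigma : 'M[C]_(D ^ n)) v : T ^t* = T -> sigma = B *m B ^t* ->
  fro (T *m (Fw v *m B)) = \sum_x \sum_x' (win v x && win v x')%:R *
    complex.Re ((T *m T) x x' * sigma x' x).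
Proof.
move=> hT eS; rewrite -rtrace_fro rtraceC !adjM hT /Fw rdiag_adj.
set F := rdiag _.
rewrite (_ : _ *m _ = T *m F *m sigma *m F *m T); last by rewrite eS !mulmxA.
rewrite (_ : T *m F *m sigma *m F *m T = T *m (F *m sigma *m F *m T)); last by rewrite !mulmxA.
rewrite rtraceC -(mulmxA _ T) rtraceC.
rewrite /rtrace trace_sum2 Rec_sum; apply: eq_bigr => x _.
rewrite Rec_sum; apply: eq_bigr => x' _.
rewrite mul_mx_rdiag mul_rdiag -mulrA mulrCA RecM mulrA [_ * (_)%:C]mulrC RecM.
by rewrite mulrA -natrM mulnb andbC.
Qed.

Lemma tdiff_herm : tdiff ^t* = tdiff.
Proof. by rewrite /tdiff adjB !adjM !rdiag_adj trmxCK mulmxA. Qed.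

Definition pairop (j k i : 'I_n) : 'M[C]_D :=
  (if i == j then tdiff else 1%:M) *m (if i == k then tdiff else 1%:M).

Lemma sitesum_sqr : sitesum n tdiff *m sitesum n tdiff =
  \sum_j \sum_k bigtens (pairop j k).
Proof.
rewrite /sitesum mulmx_suml; apply: eq_bigr => j _; rewrite mulmx_sumr.
by apply: eq_bigr => k _; rewrite onsiteM.
Qed.

(** The summands bound the cases j = k, with the square of [tdiff] at one site, and j <> k, with
    [tdiff] at two sites. *)
Definition tconst : R := norm1 (tdiff *m tdiff) + norm1 tdiff ^+ 2.

Context (omega : 'I_n -> 'M[C]_D) (d_omega : forall j, density (omega j))
  (mean0 : forall j, \tr (tdiff *m omega j) = 0).

Let sigma := bigtens omega.

Lemma pairop_norm j k : \prod_i \sum_x \sum_y normc (pairop j k i x y) *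
  normc (omega i y x) <= tconst.
Proof.
have nn i : 0 <= \sum_x \sum_y normc (pairop j k i x y) * normc (omega i y x).
  by do 2![apply: sumr_ge0 => ? _]; rewrite mulr_ge0 ?normc_ge0.
have off i : i != j -> i != k ->
    \sum_x \sum_y normc (pairop j k i x y) * normc (omega i y x) = 1.
  by move=> /negbTE ij /negbTE ik; rewrite /pairop ij ik mulmx1 sum_normc_density1.
rewrite (bigD1 j)//=; move: off; case: (eqVneq j k) => [<-|jk] off.
  rewrite [X in _ * X]big1 => [|i ij]; last by rewrite off.
  rewrite mulr1 /pairop eqxx (le_trans (sum_normc_density _ (d_omega j)))//.
  by rewrite /tconst lerDl sqr_ge0.
rewrite [X in _ * X](bigD1 k) 1?eq_sym//= [X in _ * (_ * X)]big1 => [|i /andP[ij ik]]; last exact: off.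
rewrite mulr1 /tconst -[leLHS]add0r lerD ?norm1_ge0// expr2.
apply: ler_pM => //; rewrite /pairop eqxx.
  by rewrite (negbTE jk) mulmx1 sum_normc_density.
by rewrite eq_sym (negbTE jk) mul1mx sum_normc_density.
Qed.

(** For k <> j the factor at site j is a mean, which is 0 by [mean0]; only the n diagonal pairs
    remain. *)
Lemma variance_sitesum :
  rtrace (sitesum n tdiff *m sitesum n tdiff *m sigma) <= n%:R * tconst.
Proof.
rewrite sitesum_sqr mulmx_suml rtrace_sum mulr_natl -[n in leRHS]card_ord -sumr_const.
apply: ler_sum => j _; rewrite mulmx_suml rtrace_sum (bigD1 j)//= big1 ?addr0.
  rewrite bigtensM /rtrace trace_bigtens; apply: (le_trans (Re_le_normc _)).
  rewrite normc_prod; apply: le_trans (pairop_norm j j).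
  by apply: ler_prod => i _; rewrite normc_ge0/= rtrace_le_normc.
move=> k kj; rewrite bigtensM /rtrace trace_bigtens (bigD1 j)//=.
by rewrite /pairop eqxx eq_sym (negbTE kj) mulmx1 mean0 mul0r.
Qed.

(* (K - L)^2 couples only words that differ in at most two letters, and the
   levels of such words are close: conjugating by the windows hardly changes
   it. *)
Lemma pairop_local j k x x' : bigtens (pairop j k) x x' != 0 ->
  `|wsum lam x - wsum lam x'| <= 2 * Lam.
Proof.
rewrite bigtensE => nz.
have off i : i != j -> i != k -> dig x i = dig x' i.
  move=> /negbTE ij /negbTE ik; apply/eqP; apply: contraNT nz => xx'.
  by rewrite (bigD1 i)//= /pairop ij ik mulmx1 mxE (negbTE xx') mul0r.
rewrite /wsum -sumrB; apply: (le_trans (ler_norm_sum _ _ _)).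
have -> : 2 * Lam = \sum_(i < n) ((if i == j then Lam else 0) + (if i == k then Lam else 0)).
  by rewrite big_split/= -!big_mkcond/= !big_pred1_eq; ring.
apply: ler_sum => i _.
have dle a b : `|lam a - lam b| <= Lam.
  have := lam_ge0 a; have := lam_ge0 b; have := lam_le a; have := lam_le b.
  by move=> *; rewrite ler_norml; lra.
have [->|ij] := eqVneq i j.
  by apply: (le_trans (dle _ _)); rewrite lerDl; case: ifP.
have [->|ik] := eqVneq i k; first by rewrite add0r dle.
by rewrite off// subrr normr0 addr0.
Qed.

(** Replacing [cnt] by m gives m times the variance. The correction carries the weight m - [cnt], at
    most 2 [Lam] + 1 on the entries that occur. Taking moduli there loses the cancellation between
    sites, hence n^2 in place of n, but this term has no factor m. *)
Lemma sum_fro_window (B : 'M[C]_(D ^ n)) : sigma = B *m B ^t* ->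
  \sum_(v < nwin) fro (sitesum n tdiff *m (Fw v *m B)) <=
  m%:R * (n%:R * tconst) + (2 * Lam + 1) * (n%:R ^+ 2 * tconst).
Proof.
move=> eS; have hT : (sitesum n tdiff) ^t* = sitesum n tdiff.
  by rewrite sitesum_adj tdiff_herm.
under eq_bigr do rewrite (fro_sandwich _ hT eS).
rewrite exchange_big/=; under eq_bigr do rewrite exchange_big/=.
set T2 := _ *m _.
have -> : \sum_x \sum_x' \sum_(v < nwin) (win v x && win v x')%:R *
    complex.Re (T2 x x' * sigma x' x) =
    m%:R * rtrace (T2 *m sigma) - \sum_x \sum_x' (m%:R - cnt x x') *
      complex.Re (T2 x x' * sigma x' x).
  rewrite /rtrace trace_sum2 Rec_sum mulr_sumr -sumrB; apply: eq_bigr => x _.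
  rewrite Rec_sum mulr_sumr -sumrB; apply: eq_bigr => x' _.
  by rewrite -mulr_suml -/(cnt x x'); ring.
apply: lerD; first by rewrite ler_wpM2l ?ler0n// variance_sitesum.
rewrite -sumrN.
apply: (@le_trans _ _ (\sum_x \sum_x' \sum_j \sum_k (2 * Lam + 1) *
    (normc (bigtens (pairop j k) x x') * normc (sigma x' x)))).
  apply: ler_sum => x _; rewrite -sumrN; apply: ler_sum => x' _.
  apply: (@le_trans _ _ ((m%:R - cnt x x') * normc (T2 x x' * sigma x' x))).
    rewrite -mulrN ler_wpM2l ?subr_ge0 ?cnt_le//.
    by rewrite -RecN -normcN; exact: Re_le_normc.
  rewrite normcM /T2 sitesum_sqr summxE mulrA.
  apply: (@le_trans _ _ ((m%:R - cnt x x') *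
      (\sum_j \sum_k normc (bigtens (pairop j k) x x')) * normc (sigma x' x))).
    rewrite ler_wpM2r ?normc_ge0// ler_wpM2l ?subr_ge0 ?cnt_le//.
    apply: (le_trans (normc_sum _ _ _)); apply: ler_sum => j _.
    by rewrite summxE; exact: normc_sum.
  rewrite mulr_sumr mulr_suml; apply: ler_sum => j _.
  rewrite mulr_sumr mulr_suml; apply: ler_sum => k _.
  rewrite -mulrA; have [->|nz] := eqVneq (bigtens (pairop j k) x x') 0.
    by rewrite normc0 !mul0r !mulr0.
  rewrite ler_wpM2r ?mulr_ge0 ?normc_ge0//; apply: (le_trans (cnt_ge _ _)).
  by rewrite lerD2r (pairop_local nz).
under eq_bigr => x _ do rewrite exchange_big/=.
rewrite exchange_big/= (_ : _ ^+ 2 * _ = \sum_(j < n) \sum_(k < n) tconst); last first.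
  by rewrite !sumr_const !card_ord -mulr_natl -[in RHS]mulr_natl; ring.
rewrite mulr_sumr; apply: ler_sum => j _.
under eq_bigr => x _ do rewrite exchange_big/=.
rewrite exchange_big/= mulr_sumr; apply: ler_sum => k _.
rewrite (_ : \sum_x _ = (2 * Lam + 1) *
    \prod_i \sum_x \sum_y normc (pairop j k i x y) * normc (omega i y x)).
  by rewrite ler_wpM2l ?pairop_norm// addr_ge0// mulr_ge0.
rewrite -(sum2_prod_dig (fun i x y => normc (pairop j k i x y) * normc (omega i y x))).
rewrite mulr_sumr; apply: eq_bigr => x _; rewrite mulr_sumr; apply: eq_bigr => y _.
by congr (_ * _); rewrite /sigma !bigtensE !normc_prod big_split.
Qed.

Lemma wtest_type1 : rtrace ((1%:M - wtest) *m sigma) <= Delta ^- 2 *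
  (2 * m%:R ^+ 2 + 2 * (n%:R * tconst) +
   2 * ((2 * Lam + 1) * (n%:R ^+ 2 * tconst)) / m%:R).
Proof.
have [B0 _ eS] := psd_bigtens (fun j => (d_omega j).1).
rewrite -/sigma in eS; set B := bigtens B0 in eS.
have froB : fro B = 1.
  rewrite -rtrace_fro rtraceC -eS /rtrace /sigma trace_bigtens big1//.
  by move=> j _; exact: (d_omega j).2.
have key (H : 'M[C]_(D ^ n)) : rtrace (H ^t* *m H *m sigma) = fro (H *m B).
  by rewrite -rtrace_fro adjM eS mulmxA rtraceC !mulmxA.
have -> : rtrace ((1%:M - wtest) *m sigma) = m%:R^-1 * \sum_(v < nwin) fro (Hw v *m B).
  rewrite wtestC -scalemxAl rtraceZ mulmx_suml rtrace_sum; congr (_ * _).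
  by apply: eq_bigr => v _; exact: key.
have sumF : \sum_(v < nwin) fro (Fw v *m B) = m%:R.
  under eq_bigr do rewrite /Fw fro_rdiagE.
  rewrite exchange_big/= -[RHS]mulr1 -[X in _ = _ * X]froB /fro mulr_sumr; apply: eq_bigr => x _.
  rewrite -mulr_suml -(sum_winR x); congr (_ * _); apply: eq_bigr => v _.
  by case: win; rewrite ?expr1n ?expr0n.
rewrite ler_pdivrMl ?mR_gt0//.
apply: (@le_trans _ _ (\sum_(v < nwin) Delta ^- 2 * (2 * (m%:R ^+ 2 * fro (Fw v *m B)) +
    2 * fro (sitesum n tdiff *m (Fw v *m B))))).
  by apply: ler_sum => v _; exact: fro_Hw_le.
rewrite -mulr_sumr mulrCA ler_wpM2l ?invr_ge0 ?sqr_ge0// big_split/= -!mulr_sumr sumF.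
apply: (@le_trans _ _ (2 * (m%:R ^+ 2 * m%:R) + 2 * (m%:R * (n%:R * tconst) +
  (2 * Lam + 1) * (n%:R ^+ 2 * tconst)))).
  by rewrite lerD2l ler_wpM2l// sum_fro_window.
have m0 : m%:R != 0 :> R by rewrite gt_eqF ?mR_gt0.
by rewrite le_eqVlt; apply/orP; left; apply/eqP; field.
Qed.

End WindowTest.

Lemma sqrt_floor (n : nat) : exists m : nat, (m ^ 2 <= n < m.+1 ^ 2)%N.
Proof.
elim: n => [|n [m /andP[h1 h2]]]; first by exists 0%N.
have [h|h] := ltnP n.+1 (m.+1 ^ 2); first by exists m; lia.
by exists m.+1; nia.
Qed.

Lemma exists_nat_ge (R : realType) (a : R) : exists k : nat, a <= k%:R.
Proof.
exists (Num.trunc `|a|).+1.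
have /andP[_ h] := truncn_itv (normr_ge0 a).
exact: le_trans (ler_norm _) (ltW h).
Qed.

Section DirectSite.
Context {R : realType} {D : nat} (lam kap w : 'I_D -> R) (W : 'M[R[i]]_D).
Local Notation C := R[i].
Context (uW : W \is unitarymx) (w_ge0 : forall x, 0 <= w x).

(** One-site trace of the weight w against exp of K, written in the two eigenbases; [direct_part]
    identifies it with Tr exp k. *)
Definition partition_sum : R := \sum_x \sum_y w x * expR (kap y) * sqmod (W y x).

(** [level] is a natural number, so the spectrum of L must be nonnegative. Shifting both spectra by
    the same B leaves K - L unchanged. *)
Let B : R := \sum_x `|lam x|.
Let lam' x := lam x + B.
Let kap' x := kap x + B.

Lemma lam_bound x : `|lam x| <= B.
Proof. by rewrite /B (bigD1 x)//= lerDl sumr_ge0. Qed.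

Lemma shift_ge0 : 0 <= B. Proof. by rewrite /B sumr_ge0. Qed.

Lemma lam_shift_ge0 x : 0 <= lam' x.
Proof. by have := lam_bound x; rewrite ler_norml /lam' => /andP[h _]; lra. Qed.

Lemma lam_shift_le x : lam' x <= 2 * B.
Proof. by have := lam_bound x; rewrite ler_norml /lam' => /andP[_ h]; lra. Qed.

Lemma tdiff_shift : tdiff lam' kap' W = tdiff lam kap W.
Proof.
rewrite /tdiff !rdiagD rdiag_const mulmxDr mulmxDl scalar_mxC mul_scalar_mx.
by rewrite -scalemxAl unitary_adjl// scalemx1 opprD addrACA subrr addr0.
Qed.

Lemma wsum_shift n (a : 'I_D -> R) (x : 'I_(D ^ n)) :
  wsum (fun y => a y + B) x = wsum a x + n%:R * B.
Proof. by rewrite /wsum big_split/= sumr_const card_ord mulr_natl. Qed.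

(** A pair (x, y) that passes has L <= K + m + [Delta], so exp L is at most exp (m + [Delta]) exp K;
    dropping the acceptance indicator then lets the double sum factorise over sites. *)
Lemma wtest_type2 n m (Delta : R) : (0 < m)%N -> 0 < Delta ->
  \sum_x complex.Re (wtest n m lam' kap' Delta W x x) *
     \prod_j (w (dig x j) * expR (lam (dig x j))) <=
  expR (m%:R + Delta) * partition_sum ^+ n.
Proof.
move=> m0 D0.
have wn x : 0 <= \prod_(j < n) w (dig x j) by apply: prodr_ge0.
apply: (@le_trans _ _ (\sum_x \sum_y (expR (m%:R + Delta) *
    \prod_(j < n) (w (dig x j) * expR (kap (dig y j)) * sqmod (W (dig y j) (dig x j)))))).
  apply: ler_sum => x _.
  have p0 : 0 <= \prod_(j < n) (w (dig x j) * expR (lam (dig x j))).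
    by apply: prodr_ge0 => j _; rewrite mulr_ge0 ?expR_ge0.
  apply: (le_trans (ler_wpM2r p0 (wtest_diag kap' lam_shift_ge0 uW
    (mulr_ge0 (ler0n _ 2) shift_ge0) m0 D0 x))).
  rewrite mulr_suml; apply: ler_sum => y _.
  rewrite /Wn bigtensE sqmod_prod !big_split/= -!expR_sum mulrACA.
  set pw := \prod_(i < n) w _; set S := \prod_(j < n) sqmod _.
  set el := expR (\sum_(j < n) lam _); set ek := expR (\sum_(j < n) kap _).
  set ind := (_ <= _)%R%:R.
  rewrite [leLHS](_ : _ = pw * (ind * el) * S); last by ring.
  rewrite [leRHS](_ : _ = pw * (expR (m%:R + Delta) * ek) * S); last by ring.
  apply: ler_wpM2r; first by apply: prodr_ge0 => j _; exact: sqmod_ge0.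
  apply: ler_wpM2l; [exact: wn|]; rewrite /ek -expRD /ind /el.
  rewrite /lam' /kap' !wsum_shift.
  case: (boolP (wsum lam x + n%:R * B - m%:R - Delta <= wsum kap y + n%:R * B)%R) => h /=; last by rewrite mul0r expR_ge0.
  by rewrite mul1r ler_expR; move: h; rewrite /wsum; lra.
under eq_bigr do rewrite -mulr_sumr.
rewrite -mulr_sumr ler_wpM2l ?expR_ge0//.
rewrite (sum2_prod_dig (fun _ x y => w x * expR (kap y) * sqmod (W y x))).
by rewrite prodr_const card_ord.
Qed.

Lemma direct_site (delta eps : R) : 0 < delta -> 0 < eps ->
  exists N : nat, forall n, (N <= n)%N -> exists M : 'M[C]_(D ^ n),
  [/\ is_test M,
    forall omega : 'I_n -> 'M[C]_D, (forall j, density (omega j)) ->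
      (forall j, \tr (tdiff lam kap W *m omega j) = 0) ->
      rtrace ((1%:M - M) *m bigtens omega) <= eps &
    \sum_x complex.Re (M x x) *
      \prod_j (w (dig x j) * expR (lam (dig x j))) <=
    expR (n%:R * delta) * partition_sum ^+ n].
Proof.
move=> d0 e0.
pose c := tconst lam kap W.
have c0 : 0 <= c by rewrite /c /tconst addr_ge0 ?norm1_ge0 ?sqr_ge0.
(* With [Delta] = n delta / 2 the bound of [wtest_type1] involves m^2 / n^2, 1 / n and 1 / m, all at
   most 1 / m; A collects their coefficients. *)
pose A := (4 / delta ^+ 2) * (2 + 2 * c + 2 * ((2 * (2 * B) + 1) * c)).
have b0 := shift_ge0.
have A0 : 0 <= A.
  by rewrite /A mulr_ge0 ?divr_ge0 ?sqr_ge0// !addr_ge0 ?mulr_ge0// addr_ge0// !mulr_ge0.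
(* For m > k the first summand gives A / m <= eps; the second gives m <= m^2 delta / 2 <= n delta /
   2, so that m + [Delta] <= n delta. *)
have [k hk] := exists_nat_ge (A / eps + 2 / delta + 1).
exists (k.+1 ^ 2)%N => n hn; have [m /andP[m1 m2]] := sqrt_floor n.
have km : (k < m)%N by nia.
have m0 : (0 < m)%N by lia.
have mn : (m <= n)%N by clear -m1 m0; nia.
have kmR : k%:R <= m%:R :> R by rewrite ler_nat ltnW.
have mR : 1 <= m%:R :> R by rewrite ler1n.
have mnR : m%:R ^+ 2 <= n%:R :> R by rewrite -natrX ler_nat.
have n0 : 0 < n%:R :> R by apply: lt_le_trans mnR; rewrite exprn_gt0//; lra.
have Ae0 : 0 <= A / eps by rewrite divr_ge0// ltW.
have Ame : A / m%:R <= eps.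
  by rewrite ler_pdivrMr ?ltr0n// mulrC -ler_pdivrMr//; have := divr_ge0 (ler0n R 2) (ltW d0); lra.
have md : m%:R <= n%:R * (delta / 2).
  have : 2 / delta <= m%:R by lra.
  rewrite ler_pdivrMr// => h; apply: le_trans (_ : m%:R ^+ 2 * (delta / 2) <= _); last first.
    by rewrite ler_wpM2r// divr_ge0// ltW.
  by rewrite expr2; nra.
pose Delta := n%:R * (delta / 2).
have D0 : 0 < Delta by rewrite mulr_gt0// divr_gt0.
have B2 : 0 <= 2 * B by rewrite mulr_ge0.
exists (wtest n m lam' kap' Delta W); split.
- exact: wtest_is_test uW B2 m0 D0.
- move=> omega dw hw.
  apply: (le_trans (wtest_type1 lam_shift_ge0 lam_shift_le uW B2 m0 D0 dw _)).
    by move=> j; rewrite tdiff_shift.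
  rewrite /tconst tdiff_shift -/(tconst lam kap W) -/c; apply: le_trans Ame.
  rewrite /Delta [leLHS](_ : _ = 4 / delta ^+ 2 * (2 * (m%:R ^+ 2 / n%:R ^+ 2) + 2 * (c / n%:R) +
     2 * ((2 * (2 * B) + 1) * c) / m%:R)); last first.
    by field; rewrite !gt_eqF//= ltr0n.
  rewrite /A -[leRHS]mulrA ler_wpM2l ?divr_ge0 ?sqr_ge0//.
  have im : n%:R^-1 <= m%:R^-1 :> R.
    by rewrite lef_pV2 ?posrE ?ltr0n ?ler_nat//; exact: leq_trans mn.
  set K := (2 * (2 * B) + 1) * c.
  rewrite [leRHS](_ : _ = 2 * m%:R^-1 + 2 * (c / m%:R) + 2 * K / m%:R); last by ring.
  rewrite lerD2r lerD// ler_wpM2l//; last by rewrite ler_wpM2l.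
  apply: le_trans im; rewrite ler_pdivrMr ?exprn_gt0//.
  by rewrite [n%:R ^+ 2]expr2 mulKf ?gt_eqF.
- apply: (le_trans (wtest_type2 _ m0 D0)); rewrite ler_wpM2r//.
    by rewrite exprn_ge0// /partition_sum; do 2![apply: sumr_ge0 => ? _]; rewrite !mulr_ge0 ?expR_ge0 ?sqmod_ge0.
  by rewrite ler_expR /Delta; lra.
Qed.

End DirectSite.

(** * Block diagonal operators and the direct part *)

Section BlockDiagonal.
Context {R : realType} {r d : nat}.
Local Notation C := R[i].
Implicit Types A B : 'I_r -> 'M[C]_d.

Definition blk A : 'M[C]_(r * d) := \sum_i delta_mx i i *t A i.

Lemma blkE A u v : blk A u v =
  A (mxtens_unindex u).1 (mxtens_unindex u).2 (mxtens_unindex v).2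
    *+ ((mxtens_unindex u).1 == (mxtens_unindex v).1).
Proof.
rewrite /blk summxE (bigD1 (mxtens_unindex u).1)//= big1 => [|i iu].
  by rewrite addr0 !mxE eqxx /= eq_sym mulr_natl.
by rewrite !mxE eq_sym (negbTE iu) mul0r.
Qed.

Lemma eq_blk A B : A =1 B -> blk A = blk B.
Proof. by move=> AB; apply: eq_bigr => i _; rewrite AB. Qed.

Lemma blkM A B : blk A *m blk B = blk (fun i => A i *m B i).
Proof.
rewrite /blk mulmx_suml; apply: eq_bigr => i _; rewrite mulmx_sumr.
rewrite (bigD1 i)//= big1 => [|j ji]; rewrite tensmx_mul mul_delta_mx_cond.
  by rewrite eqxx mulr1n addr0.
by rewrite eq_sym (negbTE ji) mulr0n tens0mx.
Qed.

Lemma blk_adj A : (blk A) ^t* = blk (fun i => (A i) ^t*).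
Proof.
apply/matrixP => u v; rewrite adjE !blkE eq_sym.
by case: eqP => [->|_]; rewrite ?adjE// conjc0.
Qed.

Lemma blkB A B : blk A - blk B = blk (fun i => A i - B i).
Proof. by apply/matrixP => u v; rewrite !mxE !blkE !mxE mulrnBl. Qed.

Lemma blk_rdiag (a : 'I_r -> 'I_d -> R) :
  blk (fun i => rdiag (a i)) =
  rdiag (fun u => a (mxtens_unindex u).1 (mxtens_unindex u).2).
Proof.
apply/matrixP => u v; rewrite blkE !rdiagE -mulrnA mulnb andbC.
congr (_ *+ nat_of_bool _); rewrite -(can_eq (@mxtens_unindexK r d)).
by rewrite xpair_eqE.
Qed.

Lemma blk1 : blk (fun=> 1%:M) = 1%:M.
Proof.
rewrite (eq_blk (B := fun=> rdiag (fun=> 1))) => [|i]; last by rewrite rdiag1.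
by rewrite blk_rdiag rdiag1.
Qed.

Lemma sum_tens (K : nmodType) (f : 'I_(r * d) -> K) :
  \sum_u f u = \sum_i \sum_x f (mxtens_index (i, x)).
Proof.
rewrite pair_big/= (reindex (@mxtens_index r d)); first by apply: eq_bigr => -[].
by exists (@mxtens_unindex r d) => u _; rewrite ?mxtens_indexK ?mxtens_unindexK.
Qed.

Lemma trace_blk A : \tr (blk A) = \sum_i \tr (A i).
Proof.
rewrite /mxtrace sum_tens; apply: eq_bigr => i _; apply: eq_bigr => x _.
by rewrite blkE mxtens_indexK/= eqxx.
Qed.

Lemma blk_unitary A : (forall i, A i \is unitarymx) -> blk A \is unitarymx.
Proof.
move=> uA; apply/unitarymxP; rewrite blk_adj blkM -blk1.
by apply: eq_blk => i; exact: unitary_adjr.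
Qed.

Lemma blk_sqmod A i x j y : sqmod (blk A (mxtens_index (i, x)) (mxtens_index (j, y)))
  = (i == j)%:R * sqmod (A i x y).
Proof.
rewrite blkE !mxtens_indexK/=.
by case: eqP => _; rewrite ?mul1r// mul0r mulr0n sqmod0.
Qed.

Lemma pi_state_tens (s : 'I_r -> R) (omega : 'M[C]_d) :
  pi_state s *t omega = blk (fun i => (s i)%:C *: omega).
Proof.
apply/matrixP => u v; rewrite blkE !mxE summxE (bigD1 (mxtens_unindex u).1)//= big1.
  by rewrite addr0 !mxE eqxx /= eq_sym; case: eqP => _; rewrite ?mulr1 ?mulr0 ?mul0r.
by move=> i iu; rewrite !mxE eq_sym (negbTE iu) mulr0.
Qed.

Lemma rho_state_blk (s : 'I_r -> R) rho :
  rho_state s rho = blk (fun i => (s i)%:C *: rho i).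
Proof.
apply: eq_bigr => i _; apply/matrixP => u v.
by rewrite !mxE mulrCA.
Qed.

End BlockDiagonal.

Section DirectState.
Context {R : realType} {r d : nat} (s : 'I_r -> R).
Local Notation C := R[i].
Context (s_ge0 : forall i, 0 <= s i) (s_sum : \sum_i s i = 1).

Lemma density_pi_tens (omega : 'M[C]_d) : density omega -> density (pi_state s *t omega).
Proof.
move=> [po to]; have [B eB] := psd_factor po; split.
  rewrite pi_state_tens.
  have -> : blk (fun i : 'I_r => (s i)%:C *: omega) =
      (blk (fun i => (Num.sqrt (s i))%:C *: B ^t*)) ^t* *m
       blk (fun i => (Num.sqrt (s i))%:C *: B ^t*).
    rewrite blk_adj blkM; apply: eq_blk => i; rewrite adjZ trmxCK -scalemxAl -scalemxAr.
    by rewrite scalerA -rmorphM/= -expr2 sqr_sqrtr// eB.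
  exact: psd_gram.
rewrite pi_state_tens trace_blk; under eq_bigr do rewrite linearZ/= to mulr1.
by rewrite -sumC s_sum.
Qed.

Lemma density_conj n (U A : 'M[C]_n) : U \is unitarymx -> density A ->
  density (U *m A *m U ^t*).
Proof.
move=> uU [pA tA]; split.
  by rewrite -{1}[U]trmxCK; exact: psd_conj.
by rewrite mxtrace_mulC mulmxA unitary_adjl// mul1mx.
Qed.

Lemma direct_part (rho : 'I_r -> 'M[C]_d) (e delta eps : R) :
  (forall i, density (rho i)) -> 0 < e -> 0 < delta -> 0 < eps ->
  exists N : nat, forall n, (N <= n)%N -> exists M : 'M[C]_((r * d) ^ n),
  [/\ is_test M, (type1_error (av_hypothesis s d n) M <= eps%:E)%E &
    type2_error (ntensmx (rho_state s rho) n) M <=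
    expR (n%:R * delta) *
    rtrace (expmx (\sum_i (s i)%:C *: lnmx (rho i + (e%:C)%:M))) ^+ n].
Proof.
move=> hrho e0 d0 eps0.
have /choice[Pa hPa] : forall i, exists Pa : 'M[C]_d * ('I_d -> R),
    [/\ Pa.1 \is unitarymx, rho i = Pa.1 ^t* *m rdiag Pa.2 *m Pa.1 &
      forall x, 0 <= Pa.2 x].
  by move=> i; have [P [a [? ? ? _]]] := density_diag (hrho i); exists (P, a).
pose P i := (Pa i).1; pose a i := (Pa i).2.
have uP i : P i \is unitarymx by have [] := hPa i.
have eP i : rho i = (P i) ^t* *m rdiag (a i) *m P i by have [] := hPa i.
have a0 i x : 0 <= a i x by have [_ _] := hPa i; exact.
pose l i x := ln (a i x + e).
have eL i : lnmx (rho i + (e%:C)%:M) = (P i) ^t* *m rdiag (l i) *m P i.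
  by rewrite eP lnmx_shift.
set k := \sum_i _.
have hk : k \is hermsymmx.
  apply/hermsymP; rewrite /k adj_sum; apply: eq_bigr => i _.
  by rewrite adjZ eL; congr (_ *: _); apply/hermsymP; exact: conj_rdiag_herm.
have [V [eta [uV eV]]] := herm_diagonalize hk.
(* U diagonalises l and [blk (fun=> V)] diagonalises 1 (x) k; W is the change of basis between
   them. *)
pose U := blk P; pose W := blk (fun i => V *m (P i) ^t*).
have uU : U \is unitarymx by exact: blk_unitary.
have uW : W \is unitarymx.
  by apply: blk_unitary => i; rewrite mul_unitarymx ?trmxC_unitary.
pose lam (u : 'I_(r * d)) := l (mxtens_unindex u).1 (mxtens_unindex u).2.
pose kap (u : 'I_(r * d)) := eta (mxtens_unindex u).2.
pose w (u : 'I_(r * d)) := s (mxtens_unindex u).1.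
have eW : W = blk (fun=> V) *m U ^t* by rewrite /W /U blk_adj blkM.
have eT : U ^t* *m tdiff lam kap W *m U =
    blk (fun i => k - (P i) ^t* *m rdiag (l i) *m P i).
  rewrite /tdiff mulmxBr mulmxBl -blkB -blk_rdiag; congr (_ - _); last first.
    by rewrite /U blk_adj !blkM.
  rewrite eW adjM trmxCK !mulmxA unitary_adjl// mul1mx -!mulmxA unitary_adjl//.
  by rewrite mulmx1 -(blk_rdiag (fun=> eta)) blk_adj !blkM eV !mulmxA.
(* For each i and y the squared moduli over x sum to 1, so the eigenbasis of rho_i drops out, and
   sum_i s_i = 1 leaves Tr exp k. *)
have part : partition_sum kap w W = rtrace (expmx k).
  rewrite eV /expmx herm_calcE// rtraceC mulmxA unitary_adjr// mul1mx.
  rewrite -[rdiag _]mul1mx rtrace_rdiag /partition_sum sum_tens.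
  transitivity (\sum_i \sum_x \sum_y s i * (expR (eta y) * sqmod ((V *m (P i) ^t*) y x))).
    apply: eq_bigr => i _; apply: eq_bigr => x _; rewrite sum_tens (bigD1 i)//= [X in _ + X]big1.
      rewrite addr0; apply: eq_bigr => y _.
      by rewrite blk_sqmod eqxx mul1r /w /kap !mxtens_indexK mulrA.
    by move=> j ji; rewrite big1// => y _; rewrite blk_sqmod (negbTE ji) mul0r mulr0.
  rewrite -[RHS]mul1r -s_sum mulr_suml; apply: eq_bigr => i _.
  rewrite exchange_big mulr_sumr; apply: eq_bigr => y _.
  have u2 : V *m (P i) ^t* \is unitarymx by apply: mul_adj_unitary.
  by rewrite -!mulr_sumr (unitary_rowsum y u2) [_ y y]mxE eqxx.
have w0 u : 0 <= w u by exact: s_ge0.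
have [N hN] := direct_site lam kap uW w0 d0 eps0.
exists N => n /hN[M [tM t1 t2]] {hN}.
pose Un : 'M[C]_((r * d) ^ n) := bigtens (fun=> U).
have uUn : Un \is unitarymx by exact: bigtens_unitary.
have tM' : is_test (Un ^t* *m M *m Un).
  case: tM; rewrite /loewner_le subr0 => p1 p2; split.
    by rewrite /loewner_le subr0; exact: psd_conj.
  rewrite /loewner_le; have := psd_conj Un p2.
  by rewrite mulmxBr mulmxBl mulmx1 unitary_adjl.
exists (Un ^t* *m M *m Un); split => //.
- apply: ub_ereal_sup => _ [_ [om hom <-] <-]; rewrite lee_fin.
  pose om' (j : 'I_n) := U *m (pi_state s *t om j) *m U ^t*.
  have d' j : density (om' j) by apply: density_conj => //; exact: density_pi_tens.
  have z' j : \tr (tdiff lam kap W *m om' j) = 0.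
    rewrite /om' !mulmxA mxtrace_mulC !mulmxA eT pi_state_tens blkM trace_blk.
    under eq_bigr do rewrite -scalemxAr linearZ/= mulmxBl linearB/= mulrBr.
    rewrite sumrB -mulr_suml -sumC s_sum mul1r /k mulmx_suml raddf_sum -sumrB.
    rewrite big1// => i _; apply/eqP; rewrite eL -scalemxAl subr_eq0; apply/eqP.
    exact: mxtraceZ.
  have := t1 om' d' z'; apply: le_trans; rewrite le_eqVlt; apply/orP; left; apply/eqP.
  have -> : bigtens om' = Un *m bigtens (fun j => pi_state s *t om j) *m Un ^t*.
    by rewrite /Un bigtens_adj !bigtensM.
  have -> : 1%:M - Un ^t* *m M *m Un = Un ^t* *m (1%:M - M) *m Un.
    by rewrite mulmxBr mulmxBl mulmx1 (unitary_adjl uUn).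
  move: (bigtens _) => Z; rewrite -!mulmxA [LHS]rtraceC.
  by rewrite -!mulmxA.
- rewrite /type2_error -bigtens_const -part; apply: le_trans t2.
  have -> : bigtens (fun _ : 'I_n => rho_state s rho) = Un ^t* *m
     rdiag (fun x => \prod_j (s (mxtens_unindex (dig x j)).1 *
       a (mxtens_unindex (dig x j)).1 (mxtens_unindex (dig x j)).2)) *m Un.
    rewrite -(bigtens_rdiag (fun _ u => s (mxtens_unindex u).1 *
       a (mxtens_unindex u).1 (mxtens_unindex u).2)) /Un bigtens_adj !bigtensM.
    apply: eq_bigtens => j; rewrite -(blk_rdiag (fun i x => s i * a i x)).
    rewrite rho_state_blk /U blk_adj !blkM; apply: eq_blk => i.
    by rewrite eP rdiagZ -scalemxAr -scalemxAl.
  rewrite -!mulmxA rtraceC -!mulmxA unitary_adjr// mulmx1 (mulmxA Un) unitary_adjr// mul1mx.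
  rewrite rtrace_rdiag; apply: ler_sum => x _; rewrite mulrC.
  apply: ler_wpM2l.
    case: tM => -[_ p] _; have := p (delta_mx x 0).
    rewrite subr0 mxE (bigD1 x)//= big1 => [|y yx]; last by rewrite [X in _ * X]mxE (negbTE yx) mulr0.
    rewrite [X in _ * X]mxE !eqxx mulr1 addr0 mxE (bigD1 x)//= big1 => [|y yx]; last first.
      by rewrite adjE mxE (negbTE yx) conjc0 mul0r.
    by rewrite adjE mxE !eqxx conjc1 mul1r addr0 lecE => /andP[].
  (* Exponentiating the regularised logarithm gives a + e, which dominates the eigenvalue a of the
     original rho_i. *)
  apply: ler_prod => j _; rewrite mulr_ge0//= /w ler_wpM2l// /lam /l.
  by rewrite lnK ?lerDl ?ltW// posrE addrC ltr_wpDr.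
Qed.

End DirectState.

(** * The strong converse *)

Lemma fro_contraction (R : realType) N (A : 'M[R[i]]_N) (u : 'cV[R[i]]_N) :
  loewner_le (A ^t* *m A) 1%:M -> fro (A *m u) <= fro u.
Proof.
move=> [_ /(_ u)]; rewrite mulmxBr mulmx1 mulmxBl.
rewrite (_ : u ^t* *m (A ^t* *m A) *m u = (A *m u) ^t* *m (A *m u)); last first.
  by rewrite adjM !mulmxA.
move=> h; rewrite -lecR -!fro_trace /mxtrace !big_ord1 -subr_ge0.
by move: h; rewrite [X in 0 <= X]mxE [X in _ + X]mxE.
Qed.

Lemma colsum_sqmodD_le (R : realType) m N (Y Z : 'M[R[i]]_(m, N)) y :
  \sum_i sqmod ((Y + Z) i y) <=
  2 * (\sum_i sqmod (Y i y)) + 2 * (\sum_i sqmod (Z i y)).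
Proof.
rewrite !mulr_sumr -big_split/=; apply: ler_sum => i _.
by rewrite mxE; exact: sqmodD_le.
Qed.

Lemma colsum_mul (R : realType) m n N (Y : 'M[R[i]]_(m, n)) (Z : 'M[R[i]]_(n, N)) y :
  \sum_i sqmod ((Y *m Z) i y) = fro (Y *m col y Z).
Proof.
apply: eq_bigr => i _; rewrite big_ord1 !mxE.
by congr sqmod; apply: eq_bigr => k _; rewrite mxE.
Qed.

Section StrongConverse.
Context {R : realType} {D : nat} (p q : 'I_D -> R) (U V : 'M[R[i]]_D).
Local Notation C := R[i].
Context (p_ge0 : forall x, 0 <= p x) (q_ge0 : forall y, 0 <= q y)
  (q_sum : \sum_y q y = 1) (uU : U \is unitarymx) (uV : V \is unitarymx).

Let W := U *m V ^t*.

(* The joint distribution of Nussbaum and Szkola. *)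
Definition nsz x y : R := q y * sqmod (W x y).

Context (supp : forall x y, p x = 0 -> nsz x y = 0).

(** The convention ln 0 = 0 acts only on pairs of weight zero: [supp] covers p x = 0, and q y = 0
    makes [nsz] vanish. The mean of [llr] under [nsz] is therefore the quantum relative entropy of
    the two states, although they need not commute. *)
Definition llr x y : R := ln (q y) - ln (p x).

Definition relent : R := \sum_x \sum_y nsz x y * llr x y.

Definition relvar : R := \sum_x \sum_y nsz x y * (llr x y - relent) ^+ 2.

Lemma nsz_ge0 x y : 0 <= nsz x y.
Proof. by rewrite mulr_ge0 ?sqmod_ge0. Qed.

Lemma overlap_unitary : W \is unitarymx.
Proof. by apply: mul_adj_unitary. Qed.

Lemma nsz_sum : \sum_x \sum_y nsz x y = 1.
Proof.
rewrite exchange_big -[RHS]q_sum; apply: eq_bigr => y _.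
by rewrite -mulr_sumr (unitary_colsum y overlap_unitary) mulr1.
Qed.

Lemma relvar_ge0 : 0 <= relvar.
Proof. by do 2![apply: sumr_ge0 => ? _]; rewrite mulr_ge0 ?nsz_ge0 ?sqr_ge0. Qed.

Lemma llr_centered : \sum_x \sum_y nsz x y * (llr x y - relent) = 0.
Proof.
under eq_bigr => x _ do under eq_bigr do rewrite mulrBr.
under eq_bigr do rewrite sumrB -mulr_suml.
by rewrite sumrB -mulr_suml nsz_sum mul1r /relent subrr.
Qed.

Definition pairw n (j k i : 'I_n) x y : R := nsz x y *
  ((if i == j then llr x y - relent else 1) * (if i == k then llr x y - relent else 1)).

Lemma pairw_prod n (j k : 'I_n) x y :
  \prod_i pairw j k i (dig x i) (dig y i) =
  \prod_i nsz (dig x i) (dig y i) *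
  ((llr (dig x j) (dig y j) - relent) * (llr (dig x k) (dig y k) - relent)).
Proof.
rewrite !big_split/=; congr (_ * (_ * _)).
  by rewrite -big_mkcond/= big_pred1_eq.
by rewrite -big_mkcond/= big_pred1_eq.
Qed.

(** The letters are independent under the product law, and [llr_centered] annihilates the terms with
    j <> k. *)
Lemma second_moment n :
  \sum_(x : 'I_(D ^ n)) \sum_(y : 'I_(D ^ n)) \prod_j nsz (dig x j) (dig y j) *
    (\sum_j (llr (dig x j) (dig y j) - relent)) ^+ 2 = n%:R * relvar.
Proof.
transitivity (\sum_(x : 'I_(D ^ n)) \sum_(y : 'I_(D ^ n)) \sum_(j < n) \sum_(k < n)
    \prod_i pairw j k i (dig x i) (dig y i)).
  apply: eq_bigr => x _; apply: eq_bigr => y _; rewrite expr2 mulr_suml mulr_sumr.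
  apply: eq_bigr => j _; rewrite mulr_sumr mulr_sumr; apply: eq_bigr => k _.
  by rewrite pairw_prod.
under eq_bigr => x _ do rewrite exchange_big/=.
rewrite exchange_big/= mulr_natl -[n in RHS]card_ord -sumr_const; apply: eq_bigr => j _.
under eq_bigr => x _ do rewrite exchange_big/=.
rewrite exchange_big/= (bigD1 j)//= [X in _ + X]big1 ?addr0.
  rewrite (sum2_prod_dig (pairw j j)) (bigD1 j)//= [X in _ * X]big1 ?mulr1.
    rewrite /pairw eqxx /relvar; apply: eq_bigr => x _; apply: eq_bigr => y _.
    by rewrite expr2.
  move=> i /negbTE ij; rewrite /pairw ij mulr1 -[RHS]nsz_sum.
  by apply: eq_bigr => x _; apply: eq_bigr => y _; rewrite mulr1.
move=> k kj; rewrite (sum2_prod_dig (pairw j k)) (bigD1 j)//=.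
rewrite /pairw eqxx eq_sym (negbTE kj).
under [X in X * _]eq_bigr => x _ do under eq_bigr do rewrite mulr1.
by rewrite llr_centered mul0r.
Qed.

Definition nszn n (x y : 'I_(D ^ n)) : R := \prod_j nsz (dig x j) (dig y j).

Lemma nszn_ge0 n (x y : 'I_(D ^ n)) : 0 <= nszn x y.
Proof. by apply: prodr_ge0 => j _; exact: nsz_ge0. Qed.

Lemma chebyshev_llr n (delta : R) : (0 < n)%N -> 0 < delta ->
  \sum_(x : 'I_(D ^ n)) \sum_(y : 'I_(D ^ n)) nszn x y *
    (n%:R * (relent + delta) < \sum_j llr (dig x j) (dig y j))%R%:R
  <= relvar / (n%:R * delta ^+ 2).
Proof.
move=> n0 d0; have nR : 0 < n%:R :> R by rewrite ltr0n.
have nd : 0 < n%:R * delta by rewrite mulr_gt0.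
rewrite ler_pdivlMr; last by rewrite mulr_gt0 ?exprn_gt0.
rewrite -(ler_pM2r nR) [leRHS]mulrC -second_moment -mulrA [leLHS]mulrC mulr_sumr.
apply: ler_sum => x _; rewrite mulr_sumr; apply: ler_sum => y _.
rewrite mulrCA ler_wpM2l ?nszn_ge0//.
case: (boolP (_ < \sum_j _)%R) => h; last by rewrite mulr0 sqr_ge0.
rewrite mulr1 sumrB sumr_const card_ord -(mulr_natl relent n).
rewrite (_ : n%:R * delta ^+ 2 * n%:R = (n%:R * delta) ^+ 2); last by ring.
by rewrite ler_pXn2r ?nnegrE//; lra.
Qed.

Let B : R := \sum_y `|ln (q y)|.

Lemma q_le1 y : q y <= 1.
Proof. by rewrite -q_sum (bigD1 y)//= lerDl sumr_ge0. Qed.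

Lemma lnq_bound y : - B <= ln (q y) <= 0.
Proof.
rewrite ln_le0 ?q_le1// andbT lerNl.
apply: (le_trans (ler_norm _)); rewrite normrN /B (bigD1 y)//= lerDl.
by rewrite sumr_ge0.
Qed.

Section Block.
Context (n : nat) (delta : R).
Context (n_gt0 : (0 < n)%N) (delta_gt0 : 0 < delta).

Let nd : R := n%:R * delta.
Let Un : 'M[C]_(D ^ n) := bigtens (fun=> U).
Let Vn : 'M[C]_(D ^ n) := bigtens (fun=> V).
Let Wq : 'M[C]_(D ^ n) := Un *m Vn ^t*.
Let pn (x : 'I_(D ^ n)) : R := \prod_j p (dig x j).
Let qn (y : 'I_(D ^ n)) : R := \prod_j q (dig y j).
Let lp (x : 'I_(D ^ n)) : R := \sum_j ln (p (dig x j)).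
Let lq (y : 'I_(D ^ n)) : R := \sum_j ln (q (dig y j)).

(* Eigenvalues of the null state are grouped in bins of ratio e^(n delta); their
   number does not depend on [n]. *)
Definition nbin : nat := (Num.trunc (B / delta)).+1.
Let bin (y : 'I_(D ^ n)) : nat := Num.trunc ((lq y + n%:R * B) / nd).
Let edge (b : nat) : R := b%:R * nd - n%:R * B.
Let good (b : nat) (x : 'I_(D ^ n)) : bool :=
  (0 < pn x) && (edge b - n%:R * (relent + delta) <= lp x).

Lemma nR_gt0 : 0 < n%:R :> R. Proof. by rewrite ltr0n. Qed.

Lemma nd_gt0 : 0 < nd. Proof. by rewrite mulr_gt0 ?nR_gt0. Qed.

Lemma Un_unitary : Un \is unitarymx. Proof. exact: bigtens_unitary. Qed.
Lemma Vn_unitary : Vn \is unitarymx. Proof. exact: bigtens_unitary. Qed.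
Lemma Wq_unitary : Wq \is unitarymx.
Proof. exact: mul_adj_unitary Un_unitary Vn_unitary. Qed.

Lemma pn_ge0 x : 0 <= pn x. Proof. exact: prodr_ge0. Qed.
Lemma qn_ge0 y : 0 <= qn y. Proof. exact: prodr_ge0. Qed.

Lemma lq_bound y : - (n%:R * B) <= lq y <= 0.
Proof.
rewrite sumr_le0 ?andbT => [|j _]; last by have /andP[] := lnq_bound (dig y j).
rewrite -mulrN mulr_natl -[n in leLHS]card_ord -sumr_const; apply: ler_sum => j _.
by have /andP[] := lnq_bound (dig y j).
Qed.

Lemma bin_arg_ge0 y : 0 <= (lq y + n%:R * B) / nd.
Proof.
by have /andP[h _] := lq_bound y; rewrite divr_ge0 ?(ltW nd_gt0)//; lra.
Qed.

Lemma bin_nbin y : (bin y < nbin)%N.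
Proof.
rewrite /bin /nbin ltnS; apply: le_truncn.
rewrite ler_pdivrMr ?nd_gt0// /nd mulrCA mulfVK ?gt_eqF//.
by have /andP[_ h] := lq_bound y; lra.
Qed.

Lemma edge_bin y : edge (bin y) <= lq y < edge (bin y) + nd.
Proof.
have /andP[h1 h2] := truncn_itv (bin_arg_ge0 y).
rewrite ler_pdivlMr ?nd_gt0// in h1; rewrite ltr_pdivrMr ?nd_gt0// -natr1 in h2.
by rewrite /edge /bin; apply/andP; split; lra.
Qed.

Lemma qn_le_edge y : qn y <= expR (edge (bin y) + nd).
Proof.
(* If some letter has q = 0, then [lq y] is not the logarithm of [qn y], as ln 0 = 0; but [qn y] is
   then 0. *)
have [q0|/existsP[j /negP/negP qj]] := boolP [forall j, 0 < q (dig y j)].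
  have -> : qn y = expR (lq y).
    rewrite expR_sum; apply: eq_bigr => j _; rewrite lnK// posrE.
    exact: (forallP q0).
  by rewrite ler_expR; have /andP[_ /ltW] := edge_bin y.
rewrite /qn (bigD1 j)//= (_ : q _ = 0) ?mul0r ?expR_ge0//.
by apply/eqP; rewrite eq_le q_ge0 andbT leNgt.
Qed.

Lemma pn_good b x : good b x -> expR (edge b - n%:R * (relent + delta)) <= pn x.
Proof.
move=> /andP[p0 h]; have -> : pn x = expR (lp x); last by rewrite ler_expR.
rewrite expR_sum; apply: eq_bigr => j _; rewrite lnK// posrE lt_def p_ge0 andbT.
by apply: contraTN p0 => /eqP pj; rewrite /pn (bigD1 j)//= pj mul0r ltxx.
Qed.

Lemma nszn_qn x y : nszn x y = qn y * sqmod (Wq x y).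
Proof.
rewrite /nszn /nsz big_split/= -sqmod_prod; congr (_ * sqmod _).
by rewrite /Wq /Un /Vn bigtens_adj bigtensM bigtensE.
Qed.

Context (M : 'M[C]_(D ^ n)) (tM : is_test M).

Let rhon : 'M[C]_(D ^ n) := bigtens (fun=> U ^t* *m rdiag p *m U).
Let sigman : 'M[C]_(D ^ n) := bigtens (fun=> V ^t* *m rdiag q *m V).

Lemma conj_bigtens (P : 'M[C]_D) (a : 'I_D -> R) :
  bigtens (fun _ : 'I_n => P ^t* *m rdiag a *m P) =
  (bigtens (fun _ : 'I_n => P)) ^t* *m rdiag (fun x => \prod_j a (dig x j)) *m bigtens (fun=> P).
Proof. by rewrite -(bigtens_rdiag (fun=> a)) bigtens_adj !bigtensM. Qed.

Lemma gram_rtrace (A P : 'M[C]_(D ^ n)) (a : 'I_(D ^ n) -> R) :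
  rtrace (A ^t* *m A *m (P ^t* *m rdiag a *m P)) =
  \sum_x a x * \sum_i sqmod ((A *m P ^t*) i x).
Proof.
rewrite mulmxA rtraceC !mulmxA rtrace_rdiag; apply: eq_bigr => x _; congr (_ * _).
rewrite (_ : _ *m P ^t* = (A *m P ^t*) ^t* *m (A *m P ^t*)); last first.
  by rewrite adjM trmxCK !mulmxA.
rewrite mxE Rec_sum.
by apply: eq_bigr => i _; rewrite adjE Re_mulJ.
Qed.

(** A cut-off of pairs (x, y) couples both indices and is no matrix product. Binning y replaces it
    by one projection [G b] on the x side per bin, at the price of the factor [nbin]. For good x and
    y in the bin, [qn y] is at most exp (n (relent + 2 delta)) [pn x], one delta being the width of
    the bin; the bad part is bounded by contractivity of the factor A of M and Chebyshev's
    inequality. *)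
Lemma converse_bound : rtrace (M *m sigman) <=
  2 * (nbin%:R * (expR (n%:R * (relent + 2 * delta)) * rtrace (M *m rhon))) +
  2 * (relvar / (n%:R * delta ^+ 2)).
Proof.
have [p1 p2] := tM; rewrite /loewner_le subr0 in p1.
have [A0 eA0] := psd_factor p1; pose A := A0 ^t*.
have eA : M = A ^t* *m A by rewrite /A trmxCK.
pose X := A *m Un ^t*.
have eV : A *m Vn ^t* = X *m Wq.
  by rewrite /X /Wq mulmxA -(mulmxA A) unitary_adjl ?Un_unitary// mulmx1.
have contr (u : 'cV[C]_(D ^ n)) : fro (X *m u) <= fro u.
  rewrite /X -mulmxA -[leRHS](fro_unitaryl u (U := Un ^t*)); last first.
    by rewrite trmxC_unitary Un_unitary.
  by apply: fro_contraction; rewrite -eA.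
pose G b : 'M[C]_(D ^ n) := rdiag (fun x => (good b x)%:R).
pose H b : 'M[C]_(D ^ n) := rdiag (fun x => (~~ good b x)%:R).
have GH b : G b + H b = 1%:M.
  by rewrite -rdiagD -rdiag1; apply: eq_rdiag => x; case: good; rewrite ?addr0 ?add0r.
pose a x := \sum_i sqmod (X i x).
have a_ge0 x : 0 <= a x by apply: sumr_ge0 => i _; exact: sqmod_ge0.
have eB : rtrace (M *m rhon) = \sum_x pn x * a x.
  by rewrite /rhon conj_bigtens eA gram_rtrace.
have eS : rtrace (M *m sigman) = \sum_y qn y * \sum_i sqmod ((X *m Wq) i y).
  by rewrite /sigman conj_bigtens eA gram_rtrace eV.
have split y : \sum_i sqmod ((X *m Wq) i y) <=
    2 * (\sum_i sqmod ((X *m G (bin y) *m Wq) i y)) +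
    2 * (\sum_x (~~ good (bin y) x)%:R * sqmod (Wq x y)).
  have -> : X *m Wq = X *m G (bin y) *m Wq + X *m H (bin y) *m Wq.
    by rewrite -mulmxDl -mulmxDr GH mulmx1.
  apply: (@le_trans _ _ (2 * (\sum_i sqmod ((X *m G (bin y) *m Wq) i y)) +
      2 * (\sum_i sqmod ((X *m H (bin y) *m Wq) i y)))).
    exact: colsum_sqmodD_le.
  rewrite lerD2l ler_wpM2l//.
  have -> : \sum_i sqmod ((X *m H (bin y) *m Wq) i y) =
      fro (X *m (H (bin y) *m col y Wq)).
    by rewrite colsum_mul mulmxA.
  apply: (le_trans (contr _)); rewrite fro_rdiagE; apply: ler_sum => x _.
  by rewrite big_ord1 mxE; case: good; rewrite ?expr1n// expr0n.
pose E b := expR (edge b + nd).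
have S1 : \sum_y qn y * \sum_i sqmod ((X *m G (bin y) *m Wq) i y) <=
    nbin%:R * (expR (n%:R * (relent + 2 * delta)) * rtrace (M *m rhon)).
  have s0 b y : 0 <= \sum_i sqmod ((X *m G b *m Wq) i y).
    by apply: sumr_ge0 => i _; exact: sqmod_ge0.
  (* Letting b range over all bins adds nonnegative terms only and makes the sum over y free, so
     that the unitary [Wq] disappears from the Frobenius norm. *)
  apply: (@le_trans _ _ (\sum_y \sum_(b < nbin) E b * \sum_i sqmod ((X *m G b *m Wq) i y))).
    apply: ler_sum => y _; rewrite (bigD1 (Ordinal (bin_nbin y)))//=.
    rewrite -[leLHS]addr0 lerD ?ler_wpM2r ?qn_le_edge//.
    by apply: sumr_ge0 => b _; rewrite mulr_ge0 ?expR_ge0.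
  rewrite exchange_big/= mulr_natl -[nbin in leRHS]card_ord -sumr_const.
  apply: ler_sum => b _; rewrite -mulr_sumr exchange_big/= -/(fro _).
  rewrite fro_unitaryr ?Wq_unitary// eB.
  rewrite (_ : n%:R * (relent + 2 * delta) = (edge b + nd) -
    (edge b - n%:R * (relent + delta))); last by rewrite /nd; ring.
  rewrite expRD -mulrA ler_wpM2l ?expR_ge0// /fro exchange_big/= mulr_sumr.
  apply: ler_sum => x _.
  under eq_bigr do rewrite mul_mx_rdiag sqmodM sqmod_real.
  rewrite -mulr_suml -/(a x) mulrC mulrA ler_wpM2r//.
  case: (boolP (good b x)) => g; last by rewrite expr0n/= mulr_ge0 ?expR_ge0 ?pn_ge0.
  by rewrite expr1n expRN ler_pdivlMl ?expR_gt0// mulr1; exact: pn_good g.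
have S2 : \sum_y qn y * (\sum_x (~~ good (bin y) x)%:R * sqmod (Wq x y)) <=
    relvar / (n%:R * delta ^+ 2).
  apply: le_trans (chebyshev_llr n_gt0 delta_gt0).
  rewrite [leRHS]exchange_big/=; apply: ler_sum => y _.
  rewrite mulr_sumr; apply: ler_sum => x _.
  rewrite mulrCA -nszn_qn mulrC.
  have [->|nz] := eqVneq (nszn x y) 0; first by rewrite !mul0r.
  have px : 0 < pn x.
    rewrite lt_def pn_ge0 andbT; apply: contra nz => /prodf_eq0[j _ /eqP pj].
    by rewrite /nszn (bigD1 j)//= supp ?mul0r.
  rewrite ler_wpM2l ?nszn_ge0// ler_nat; case: (boolP (good _ _)) => //=.
  rewrite /good px/= -ltNge lt0b => lpx.
  rewrite /llr sumrB -/(lq y) -/(lp x).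
  have /andP[h _] := edge_bin y.
  by rewrite ltrBrDr; apply: lt_le_trans h; rewrite -ltrBrDl.
rewrite eS; apply: (@le_trans _ _ (\sum_y qn y * (2 * (\sum_i sqmod ((X *m G (bin y) *m Wq) i y)) +
    2 * (\sum_x (~~ good (bin y) x)%:R * sqmod (Wq x y))))).
  by apply: ler_sum => y _; rewrite ler_wpM2l ?qn_ge0.
rewrite [leLHS](_ : _ = 2 * (\sum_y qn y * \sum_i sqmod ((X *m G (bin y) *m Wq) i y)) +
  2 * (\sum_y qn y * (\sum_x (~~ good (bin y) x)%:R * sqmod (Wq x y)))).
  by rewrite lerD// ler_wpM2l.
by rewrite !mulr_sumr -big_split/=; apply: eq_bigr => y _; ring.
Qed.

End Block.

Lemma strong_converse (delta eps : R) : 0 < delta -> eps < 1 ->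
  exists N : nat, forall n, (N <= n)%N -> forall M : 'M[C]_(D ^ n), is_test M ->
    rtrace ((1%:M - M) *m bigtens (fun=> V ^t* *m rdiag q *m V)) <= eps ->
    expR (- (n%:R * (relent + 3 * delta))) <=
      rtrace (M *m bigtens (fun=> U ^t* *m rdiag p *m U)).
Proof.
move=> d0 e1; pose g := 1 - eps.
have g0 : 0 < g by rewrite subr_gt0.
have v0 := relvar_ge0.
pose K := (nbin delta)%:R : R.
have K0 : 0 < K by rewrite ltr0n.
(* The first summand brings the Chebyshev term below g / 4; the second gives 4 K <= g exp (n delta),
   which absorbs the number of bins into the third delta. *)
have [k hk] := exists_nat_ge (4 * relvar / (g * delta ^+ 2) + 4 * K / (g * delta) + 1).
have gd : 0 < g * delta by rewrite mulr_gt0.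
have gd2 : 0 < g * delta ^+ 2 by rewrite mulr_gt0 ?exprn_gt0.
have t1 : 0 <= 4 * relvar / (g * delta ^+ 2) by rewrite divr_ge0 ?mulr_ge0// ltW.
have t2 : 0 <= 4 * K / (g * delta) by rewrite divr_ge0 ?mulr_ge0// ltW.
exists k => n kn M tM tI.
have knR : k%:R <= n%:R :> R by rewrite ler_nat.
have nR : 0 < n%:R :> R by lra.
have n0 : (0 < n)%N by rewrite -(ltr0n R).
set sg := bigtens _ in tI.
have trs : rtrace sg = 1.
  rewrite /rtrace /sg trace_bigtens big1// => j _.
  rewrite mxtrace_mulC mulmxA unitary_adjr// mul1mx -[RHS]/(1%:C) -q_sum sumC.
  by apply: eq_bigr => x _; rewrite rdiagE eqxx.
have h := converse_bound n0 d0 tM.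
rewrite mulmxBl mul1mx rtraceB trs in tI.
rewrite -/sg -/K in h.
set b := rtrace (M *m bigtens (fun _ : 'I_n => U ^t* *m _ *m U)) in h *.
have h1 : relvar / (n%:R * delta ^+ 2) <= g / 4.
  rewrite ler_pdivrMr ?mulr_gt0 ?exprn_gt0//.
  have : 4 * relvar / (g * delta ^+ 2) <= n%:R by lra.
  by rewrite ler_pdivrMr//; lra.
have h2 : 4 * K <= g * expR (n%:R * delta).
  apply: le_trans (_ : g * (n%:R * delta) <= _).
    have : 4 * K / (g * delta) <= n%:R by lra.
    by rewrite ler_pdivrMr//; lra.
  rewrite ler_wpM2l ?(ltW g0)//; apply: le_trans (expR_ge1Dx _); lra.
have h3 : g / 4 <= K * (expR (n%:R * (relent + 2 * delta)) * b).
  by rewrite /g in h1 *; lra.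
rewrite expRN -div1r ler_pdivrMr ?expR_gt0//.
rewrite (_ : n%:R * (relent + 3 * delta) = n%:R * (relent + 2 * delta) + n%:R * delta);
  last by ring.
rewrite expRD; set e1' := expR _ in h3 *; set e2 := expR _ in h2 *.
have b0 : 0 < e1' * b.
  by rewrite -(pmulr_rgt0 _ K0); apply: lt_le_trans h3; rewrite divr_gt0.
have : K <= e2 * (K * (e1' * b)).
  by apply: (@le_trans _ _ (e2 * (g / 4))); [lra | rewrite ler_wpM2l// expR_ge0].
rewrite mulrCA -[leLHS]mulr1 ler_pM2l//; nra.
Qed.

End StrongConverse.

(** * The optimal state on the common support *)

Section QuadraticForm.
Context {R : realType} {d : nat}.
Local Notation C := R[i].
Implicit Types (A : 'M[C]_d) (u : 'cV[C]_d).

Definition quad A u : R := complex.Re ((u ^t* *m A *m u) 0 0).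

Lemma quadE (P : 'M[C]_d) (a : 'I_d -> R) u :
  quad (P ^t* *m rdiag a *m P) u = \sum_x a x * sqmod ((P *m u) x 0).
Proof. by rewrite /quad quad_rdiag. Qed.

Lemma quad_sum r (s : 'I_r -> R) (A : 'I_r -> 'M[C]_d) u :
  quad (\sum_i (s i)%:C *: A i) u = \sum_i s i * quad (A i) u.
Proof.
rewrite /quad mulmx_sumr mulmx_suml summxE Rec_sum; apply: eq_bigr => i _.
by rewrite -scalemxAr -scalemxAl mxE RecM.
Qed.

Lemma sum_sqmod_unitary (P : 'M[C]_d) u : P \is unitarymx ->
  \sum_x sqmod ((P *m u) x 0) = \sum_x sqmod (u x 0).
Proof.
move=> uP; have := fro_unitaryl u uP; rewrite /fro.
under eq_bigr do rewrite big_ord1.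
by under [RHS]eq_bigr do rewrite big_ord1.
Qed.

Lemma mul_col_adj (P Q : 'M[C]_d) a x : (P *m col a (Q ^t*)) x 0 = (P *m Q ^t*) x a.
Proof. by rewrite !mxE; apply: eq_bigr => k _; rewrite [col _ _ _ _]mxE. Qed.

(** Compares exp with its tangent at the mean m. *)
Lemma jensen_expR (w t : 'I_d -> R) : (forall y, 0 <= w y) -> \sum_y w y = 1 ->
  expR (\sum_y t y * w y) <= \sum_y expR (t y) * w y.
Proof.
move=> w0 w1; set m := \sum_y t y * w y.
have -> : expR m = \sum_y expR m * (1 + (t y - m)) * w y.
  under eq_bigr do rewrite -mulrA; rewrite -mulr_sumr.
  under eq_bigr do rewrite mulrDl mulrBl mul1r.
  by rewrite big_split/= sumrB w1 -mulr_sumr w1 mulr1 -/m subrr addr0 mulr1.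
apply: ler_sum => y _; rewrite ler_wpM2r//.
rewrite -[in leRHS](subrK m (t y)) expRD mulrC ler_wpM2r ?expR_ge0//.
exact: expR_ge1Dx.
Qed.

(* Peierls' argument: Jensen's inequality at each eigenvector of the left side. *)
Lemma peierls (X Q : 'M[C]_d) (x t : 'I_d -> R) :
  X \is unitarymx -> Q \is unitarymx ->
  (forall u, quad (X ^t* *m rdiag x *m X) u <= \sum_y t y * sqmod ((Q *m u) y 0)) ->
  \sum_a expR (x a) <= \sum_y expR (t y).
Proof.
move=> uX uQ h; have uQX : Q *m X ^t* \is unitarymx.
  by apply: mul_adj_unitary.
apply: (@le_trans _ _ (\sum_a \sum_y expR (t y) * sqmod ((Q *m X ^t*) y a))).
  apply: ler_sum => a _; apply: le_trans (jensen_expR _ _ _); last 2 first.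
  - by move=> y; exact: sqmod_ge0.
  - exact: unitary_colsum.
  rewrite ler_expR; have := h (col a (X ^t*)); rewrite quadE.
  under eq_bigr do rewrite mul_col_adj unitary_adjr//.
  under [leRHS]eq_bigr do rewrite mul_col_adj.
  rewrite (bigD1 a)//= big1 => [|y ya].
    by rewrite mxE eqxx sqmod1 mulr1 addr0.
  by rewrite mxE (negbTE ya) sqmod0 mulr0.
rewrite exchange_big/=; apply: ler_sum => y _.
by rewrite -mulr_sumr (unitary_rowsum y uQX) mulr1.
Qed.

(** Young's inequality: the cross term costs eta on z and g^2 / eta on w. *)
Lemma sqmod_cross (g c eta : R) (z w : C) : 0 < eta -> `|g| <= c ->
  g * sqmod (z + w) <= (g + eta) * sqmod z + (c ^+ 2 / eta + c) * sqmod w.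
Proof.
move=> e0 gc.
have key (a b : R) : g * (a + b) ^+ 2 <= (g + eta) * a ^+ 2 + (c ^+ 2 / eta + c) * b ^+ 2.
  have gc' : g <= c by apply: le_trans gc; exact: ler_norm.
  have g2 : g ^+ 2 <= c ^+ 2.
    by rewrite -real_normK ?num_real// ler_pXn2r ?nnegrE//; apply: le_trans gc.
  have h : 0 <= (eta * a - g * b) ^+ 2 / eta by rewrite divr_ge0 ?sqr_ge0// ltW.
  have e : (eta * a - g * b) ^+ 2 / eta = eta * a ^+ 2 - 2 * g * a * b + g ^+ 2 / eta * b ^+ 2.
    by field; rewrite gt_eqF.
  have h2 : g ^+ 2 / eta * b ^+ 2 <= c ^+ 2 / eta * b ^+ 2.
    by rewrite ler_wpM2r ?sqr_ge0// ler_wpM2r// invr_ge0 ltW.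
  have h3 : g * b ^+ 2 <= c * b ^+ 2 by rewrite ler_wpM2r ?sqr_ge0.
  rewrite e in h.
  rewrite (_ : g * (a + b) ^+ 2 = g * a ^+ 2 + 2 * g * a * b + g * b ^+ 2); last by ring.
  by rewrite mulrDl mulrDl; lra.
case: z w => [a b] [a' b']; rewrite /sqmod /=.
by have := lerD (key a a') (key b b'); rewrite !mulrDr; lra.
Qed.

(* Y + iZ is normal, and its spectral decomposition serves both Y and Z. *)
Lemma codiagonalize (Y Z : 'M[C]_d) : Y ^t* = Y -> Z ^t* = Z ->
  Y *m Z = 0 -> Z *m Y = 0 ->
  exists (Q : 'M[C]_d) (a b : 'I_d -> R), [/\ Q \is unitarymx,
    Y = Q ^t* *m rdiag a *m Q & Z = Q ^t* *m rdiag b *m Q].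
Proof.
move=> hY hZ YZ ZY; pose ii : C := Complex 0 1.
have iic : ii^* = - ii by rewrite /ii /= /GRing.opp /= oppr0.
pose N := Y + ii *: Z.
have hN : N ^t* = Y - ii *: Z.
  rewrite /N adjD hY; congr (_ + _); apply/matrixP => i j.
  rewrite adjE !mxE (_ : (ii * Z j i)^* = ii^* * (Z j i)^*); last exact: rmorphM.
  transitivity (- ii * (Z j i)^*); first by congr (_ * _); exact: iic.
  rewrite mulNr; congr (- (_ * _)).
  by have /matrixP/(_ i j) := hZ; rewrite adjE.
have nN : N \is normalmx.
  apply/normalmxP; rewrite hN /N mulmxBr mulmxDl mulmxBl mulmxDr mulmxDr.
  rewrite -!scalemxAl -!scalemxAr YZ ZY !scaler0.
  by rewrite [_ *m Z]mulmxDl YZ -!scalemxAl !add0r.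
have uQ := spectral_unitarymx N; have eN := orthomx_spectralP nN.
rewrite (invmx_unitary uQ) in eN; move: uQ eN.
move: (spectralmx N) (spectral_diag N) => Q nu uQ eN.
exists Q.
pose Y1 := Q *m Y *m Q ^t*; pose Z1 := Q *m Z *m Q ^t*.
have e1 : Y1 + ii *: Z1 = diag_mx nu.
  rewrite /Y1 /Z1 scalemxAl scalemxAr -mulmxDl -mulmxDr -/N eN.
  by rewrite !mulmxA unitary_adjr// mul1mx -mulmxA unitary_adjr// mulmx1.
have hY1 : Y1 ^t* = Y1 by rewrite /Y1 !adjM trmxCK hY mulmxA.
have hZ1 : Z1 ^t* = Z1 by rewrite /Z1 !adjM trmxCK hZ mulmxA.
have back (A : 'M[C]_d) : A = Q ^t* *m (Q *m A *m Q ^t*) *m Q.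
  by rewrite !mulmxA unitary_adjl// mul1mx -mulmxA unitary_adjl// mulmx1.
have bY := back Y; have bZ := back Z; rewrite -/Y1 -/Z1 in bY bZ.
clearbody Y1 Z1.
(* The entries (i, j) and (j, i) of Y1 + i Z1 vanish; by hermitian symmetry these are four real
   equations in four real unknowns. *)
have off i j : i != j -> Y1 i j = 0 /\ Z1 i j = 0.
  move=> ij; have /matrixP/(_ i j) := e1; have /matrixP/(_ j i) := e1.
  rewrite !mxE (negbTE ij) eq_sym (negbTE ij) !mulr0n.
  have /matrixP/(_ i j) := hY1; rewrite adjE => <-.
  have /matrixP/(_ i j) := hZ1; rewrite adjE => <-.
  case: (Y1 j i) (Z1 j i) => [a b] [a' b'] [] h1 h2 [] h3 h4.
  have E1 : a = 0 by lra.
  have E2 : b = 0 by lra.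
  have E3 : a' = 0 by lra.
  have E4 : b' = 0 by lra.
  by rewrite E1 E2 E3 E4 /= oppr0.
have real_diag (A : 'M[C]_d) : A ^t* = A -> (forall i j, i != j -> A i j = 0) ->
    A = rdiag (fun i => complex.Re (A i i)).
  move=> hA oA; apply/matrixP => i j; rewrite rdiagE.
  have [<-|ij] := eqVneq i j; last by rewrite oA.
  have /matrixP/(_ i i) := hA; rewrite adjE mulr1n.
  by case: (A i i) => a b [] h; congr Complex; lra.
have eY1 := real_diag _ hY1 (fun i j ij => (off i j ij).1).
have eZ1 := real_diag _ hZ1 (fun i j ij => (off i j ij).2).
exists (fun i => complex.Re (Y1 i i)), (fun i => complex.Re (Z1 i i)).
by split; [exact: uQ | rewrite -eY1; exact: bY | rewrite -eZ1; exact: bZ].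
Qed.

End QuadraticForm.

Lemma unitary_conjM (R : realType) n (P A B : 'M[R[i]]_n) : P \is unitarymx ->
  (P ^t* *m A *m P) *m (P ^t* *m B *m P) = P ^t* *m (A *m B) *m P.
Proof.
by move=> uP; rewrite -!mulmxA (mulmxA P (P ^t*)) (unitary_adjr uP) mul1mx.
Qed.

Lemma unitary_conj_inj (R : realType) n (P A B : 'M[R[i]]_n) : P \is unitarymx ->
  P ^t* *m A *m P = P ^t* *m B *m P -> A = B.
Proof.
move=> uP /(congr1 (fun X => P *m X *m P ^t*)).
rewrite !mulmxA (unitary_adjr uP) !mul1mx.
by rewrite -!mulmxA (unitary_adjr uP) !mulmx1.
Qed.

Lemma quad_sandwich (R : realType) n (E A : 'M[R[i]]_n) (u : 'cV[R[i]]_n) :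
  E ^t* = E -> quad (E *m A *m E) u = quad A (E *m u).
Proof. by move=> hE; rewrite /quad adjM hE !mulmxA. Qed.

Section SupportLimit.
Context {R : realType} {r d : nat} (s : 'I_r -> R).
Local Notation C := R[i].
Context (s_ge0 : forall i, 0 <= s i) (s_sum : \sum_i s i = 1).
Context (P : 'I_r -> 'M[C]_d) (p : 'I_r -> 'I_d -> R).
Context (uP : forall i, P i \is unitarymx) (p_ge0 : forall i x, 0 <= p i x).

Definition wconj (a : 'I_r -> 'I_d -> R) : 'M[C]_d :=
  \sum_i (s i)%:C *: ((P i) ^t* *m rdiag (a i) *m P i).

Definition logsum (e : R) : 'M[C]_d := wconj (fun i x => ln (p i x + e)).

(* Since [ln 0 = 0], this is the weighted sum of the logarithms on the supports. *)
Definition logsupp : 'M[C]_d := wconj (fun i x => ln (p i x)).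

Definition kersum : 'M[C]_d := wconj (fun i x => (p i x == 0)%:R).

Local Notation k0 := logsupp.
Local Notation Zk := kersum.

Lemma herm_sum (a : 'I_r -> 'I_d -> R) : wconj a \is hermsymmx.
Proof.
apply/hermsymP; rewrite adj_sum; apply: eq_bigr => i _.
by rewrite adjZ; congr (_ *: _); apply/hermsymP; exact: conj_rdiag_herm.
Qed.

Lemma quad_conj_sum (a : 'I_r -> 'I_d -> R) u :
  quad (wconj a) u = \sum_i s i * \sum_x a i x * sqmod ((P i *m u) x 0).
Proof. by rewrite quad_sum; apply: eq_bigr => i _; rewrite quadE. Qed.

Lemma quad_logsum e u : quad (logsum e) u =
  \sum_i s i * \sum_x ln (p i x + e) * sqmod ((P i *m u) x 0).
Proof. exact: (quad_conj_sum (fun i x => ln (p i x + e))). Qed.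

Lemma quad_logsupp u : quad logsupp u =
  \sum_i s i * \sum_x ln (p i x) * sqmod ((P i *m u) x 0).
Proof. exact: (quad_conj_sum (fun i x => ln (p i x))). Qed.

Lemma quad_kersum u : quad kersum u =
  \sum_i s i * \sum_x (p i x == 0)%:R * sqmod ((P i *m u) x 0).
Proof. exact: (quad_conj_sum (fun i x => (p i x == 0)%:R)). Qed.

Let pinvsum : R := \sum_i \sum_x (p i x)^-1.

Lemma pinv_le i x : (p i x)^-1 <= pinvsum.
Proof.
rewrite /pinvsum (bigD1 i)//= (bigD1 x)//= -addrA lerDl addr_ge0//.
  by apply: sumr_ge0 => y _; rewrite invr_ge0.
by do 2![apply: sumr_ge0 => ? _]; rewrite invr_ge0.
Qed.

Lemma pinvsum_ge0 : 0 <= pinvsum.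
Proof. by do 2![apply: sumr_ge0 => ? _]; rewrite invr_ge0. Qed.

(** On the support this is ln (1 + e / p) <= e / p; on the kernel ln 0 = 0 and only ln e remains,
    which tends to -oo with e and suppresses the vectors outside the common support. *)
Lemma ln_shift_le i x e : 0 < e ->
  ln (p i x + e) <= ln (p i x) + pinvsum * e + ln e * (p i x == 0)%:R.
Proof.
move=> e0; have [->|p0] := eqVneq (p i x) 0.
  by rewrite add0r (ln0 (lexx 0)) add0r mulr1 lerDr mulr_ge0 ?pinvsum_ge0 ?ltW.
have pp : 0 < p i x by rewrite lt_def p0 p_ge0.
rewrite mulr0 addr0 (_ : p i x + e = p i x * (1 + e / p i x)); last first.
  by rewrite mulrDr mulr1 mulrCA mulfV// mulr1.
have ep : 0 < e / p i x by rewrite divr_gt0.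
rewrite lnM ?posrE ?addr_gt0// lerD2l.
apply: (@le_trans _ _ (e / p i x)); last by rewrite mulrC ler_wpM2r ?pinv_le ?(ltW e0).
by rewrite -ler_expR lnK ?posrE ?addr_gt0// expR_ge1Dx.
Qed.

Lemma quad_logsum_le e u : 0 < e ->
  quad (logsum e) u <= quad k0 u + pinvsum * e * (\sum_x sqmod (u x 0)) + ln e * quad Zk u.
Proof.
move=> e0; rewrite [leLHS]quad_logsum [X in _ <= X + _ + _]quad_logsupp.
rewrite [X in _ <= _ + _ * X]quad_kersum.
have -> : pinvsum * e * (\sum_x sqmod (u x 0)) =
    \sum_i s i * \sum_x (pinvsum * e) * sqmod ((P i *m u) x 0).
  under [RHS]eq_bigr => i _ do rewrite -mulr_sumr (sum_sqmod_unitary _ (uP i)).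
  by rewrite -mulr_suml s_sum mul1r.
rewrite mulr_sumr -!big_split/=; apply: ler_sum => i _.
rewrite mulrCA -!mulrDr ler_wpM2l// mulr_sumr -!big_split/=; apply: ler_sum => x _.
by rewrite mulrA -!mulrDl ler_wpM2r ?sqmod_ge0// ln_shift_le.
Qed.

(* [beta] is the indicator of the eigenvectors orthogonal to the common support
   of the rho_i with s_i > 0, and [alpha] lists the eigenvalues of the compression
   of [logsupp] to that support. *)
Lemma support_state : exists (Q : 'M[C]_d) (alpha beta : 'I_d -> R) (zm : R),
  [/\ Q \is unitarymx, (forall y, beta y = 0 \/ beta y = 1 /\ alpha y = 0),
    (forall y, beta y = 0 -> quad k0 (col y (Q ^t*)) = alpha y
      /\ quad Zk (col y (Q ^t*)) = 0), 0 < zm &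
    forall eta : R, 0 < eta -> exists c' : R, forall u,
      quad k0 u <= \sum_y ((alpha y + eta * (1 - beta y)) + c' * beta y) *
        sqmod ((Q *m u) y 0) /\
      zm * (\sum_y beta y * sqmod ((Q *m u) y 0)) <= quad Zk u].
Proof.
have [PZ [zeta [uPZ eZ]]] := herm_diagonalize (herm_sum (fun i x => (p i x == 0)%:R)).
rewrite -/kersum in eZ.
have zeta0 x : 0 <= zeta x.
  have : psdmx Zk.
    apply: psd_sum => i _; apply: psdZ; first exact: s_ge0.
    by apply/(psdmx_rdiag _ (uP i)) => y; exact: ler0n.
  by rewrite eZ => /(psdmx_rdiag _ uPZ).
(* The kernel of [kersum] is V, so [Pi'] projects onto the complement of V and [Pi] onto V; [Y] and
   [Pi'] annihilate each other and share an eigenbasis. *)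
pose b0 x : R := (zeta x != 0)%:R.
pose Pi' := PZ ^t* *m rdiag b0 *m PZ; pose Pi := 1%:M - Pi'.
have hPi' : Pi' ^t* = Pi' by apply/hermsymP; exact: conj_rdiag_herm.
have hPi : Pi ^t* = Pi by rewrite /Pi adjB adj1 hPi'.
have iPi' : Pi' *m Pi' = Pi'.
  rewrite /Pi' (unitary_conjM _ _ uPZ) rdiagM (_ : rdiag _ = rdiag b0); first exact: erefl.
  by apply: eq_rdiag => x; rewrite /b0; case: eqP; rewrite ?mulr0 ?mulr1.
have PiPi' : Pi *m Pi' = 0 by rewrite /Pi mulmxBl mul1mx iPi' subrr.
have Pi'Pi : Pi' *m Pi = 0 by rewrite /Pi mulmxBr mulmx1 iPi' subrr.
have hk0 : k0 ^t* = k0 by apply/hermsymP; exact: herm_sum.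
pose Y := Pi *m k0 *m Pi.
have [|||Q [alpha [beta [uQ eY eP]]]] := @codiagonalize R d Y Pi' _ hPi'.
- by rewrite /Y !adjM hPi hk0 mulmxA.
- by rewrite /Y -!mulmxA PiPi' !mulmx0.
- by rewrite /Y !mulmxA Pi'Pi !mul0mx.
have [G [g [uG eG]]] := herm_diagonalize (herm_sum (fun i x => ln (p i x))).
rewrite -/logsupp in eG.
have beta2 y : beta y * beta y = beta y.
  have : rdiag beta *m rdiag beta = rdiag beta :> 'M[C]_d.
    by apply: (unitary_conj_inj uQ); rewrite -(unitary_conjM _ _ uQ) -eP.
  by rewrite rdiagM => /matrixP/(_ y y); rewrite !rdiagE eqxx => /complexI.
have alphabeta y : alpha y * beta y = 0.
  have : rdiag alpha *m rdiag beta = 0 :> 'M[C]_d.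
    apply: (unitary_conj_inj uQ); rewrite -(unitary_conjM _ _ uQ) -eP -eY.
    by rewrite /Y -!mulmxA PiPi' mul0mx !mulmx0.
  by rewrite rdiagM => /matrixP/(_ y y); rewrite rdiagE mxE eqxx => /complexI.
(* As 0^-1 = 0, the inverse of S bounds the nonzero eigenvalues of [Zk] from below; the 1 keeps S
   positive when there are none. *)
pose S : R := \sum_x (zeta x)^-1 + 1.
have S0 : 0 < S by rewrite ltr_wpDl// sumr_ge0// => x _; rewrite invr_ge0.
have quadPi' (u : 'cV[C]_d) : \sum_y beta y * sqmod ((Q *m u) y 0) = \sum_x b0 x * sqmod ((PZ *m u) x 0).
  by rewrite -!quadE -eP.
exists Q, alpha, beta, S^-1; split => //.
- move=> y; have /eqP := beta2 y; rewrite -subr_eq0 -{3}[beta y]mulr1 -mulrBr mulf_eq0.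
  case/orP => /eqP h; [by left|right]; have b1 : beta y = 1 by lra.
  by split=> //; have := alphabeta y; rewrite b1 mulr1.
- move=> y by0; set v := col y _.
  have Pv : Pi' *m v = 0.
    rewrite eP -mulmxA; apply/matrixP => a b; rewrite -(mulmxA (Q ^t*)) mxE [RHS]mxE big1// => c _.
    rewrite mul_rdiag ord1 mul_col_adj unitary_adjr// [X in _ * (_ * X)]mxE.
    by case: (eqVneq c y) => [->|_]; rewrite ?by0 ?mul0r ?mulr0.
  have Piv : Pi *m v = v by rewrite /Pi mulmxBl mul1mx Pv subr0.
  split.
    have -> : quad k0 v = quad Y v by rewrite (quad_sandwich _ _ hPi) Piv.
    rewrite eY quadE; under eq_bigr do rewrite mul_col_adj unitary_adjr//.
    rewrite (bigD1 y)//= big1 => [|x xy]; first by rewrite mxE eqxx sqmod1 mulr1 addr0.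
    by rewrite mxE (negbTE xy) sqmod0 mulr0.
  rewrite eZ quadE big1// => x _; have [->|zx] := eqVneq (zeta x) 0; first by rewrite mul0r.
  have z0 : \sum_x b0 x * sqmod ((PZ *m v) x 0) = 0.
    by rewrite -quadE -/Pi' /quad -mulmxA Pv mulmx0 mxE.
  have t0 x' : true -> 0 <= b0 x' * sqmod ((PZ *m v) x' 0).
    by move=> _; rewrite mulr_ge0 ?sqmod_ge0 ?ler0n.
  by have := psumr_eq0P t0 z0 (i := x) isT; rewrite /b0 zx mul1r => ->; rewrite mulr0.
- by rewrite invr_gt0.
move=> eta e0; pose c : R := \sum_x `|g x|.
have gc x : `|g x| <= c by rewrite /c (bigD1 x)//= lerDl sumr_ge0.
(* [k0] need not be block diagonal for V and its complement; [sqmod_cross] moves the off-diagonal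
   blocks into eta on V and this constant off V. *)
exists (c ^+ 2 / eta + c) => u; split; last first.
  rewrite quadPi' eZ quadE mulr_sumr; apply: ler_sum => x _.
  rewrite mulrA ler_wpM2r ?sqmod_ge0// /b0; have [->|zx] := eqVneq (zeta x) 0.
    by rewrite mulr0.
  rewrite mulr1 -[leRHS]invrK lef_pV2 ?posrE ?invr_gt0//; last by rewrite lt_def zx zeta0.
  rewrite /S (bigD1 x)//= -addrA lerDl addr_ge0// sumr_ge0// => y _.
  by rewrite invr_ge0.
have eu : u = Pi *m u + Pi' *m u by rewrite -mulmxDl /Pi subrK mul1mx.
have QPi' : Q *m (Pi' *m u) = rdiag beta *m (Q *m u).
  by rewrite eP -!mulmxA (mulmxA Q (Q ^t*)) (unitary_adjr uQ) mul1mx.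
have nPi' : \sum_x sqmod ((G *m (Pi' *m u)) x 0) = \sum_y beta y * sqmod ((Q *m u) y 0).
  rewrite sum_sqmod_unitary// -(sum_sqmod_unitary _ uQ); apply: eq_bigr => y _.
  rewrite QPi' mul_rdiag sqmodM sqmod_real.
  by rewrite expr2 beta2.
have nPi : \sum_x sqmod ((G *m (Pi *m u)) x 0) = \sum_y (1 - beta y) * sqmod ((Q *m u) y 0).
  rewrite sum_sqmod_unitary// -(sum_sqmod_unitary _ uQ); apply: eq_bigr => y _.
  have -> : Q *m (Pi *m u) = rdiag (fun y => 1 - beta y) *m (Q *m u).
    by rewrite rdiagB rdiag1 /Pi mulmxBl mul1mx mulmxBr QPi' [RHS]mulmxBl mul1mx.
  rewrite mul_rdiag sqmodM sqmod_real; congr (_ * _).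
  transitivity (1 - 2 * beta y + beta y * beta y); first by ring.
  by rewrite beta2; ring.
have qY : \sum_x g x * sqmod ((G *m (Pi *m u)) x 0) = \sum_y alpha y * sqmod ((Q *m u) y 0).
  by rewrite -!quadE -eY -eG (quad_sandwich _ _ hPi).
rewrite {1}eG quadE.
pose n1 x := sqmod ((G *m (Pi *m u)) x 0); pose n2 x := sqmod ((G *m (Pi' *m u)) x 0).
have e1 : \sum_x n1 x = \sum_y (1 - beta y) * sqmod ((Q *m u) y 0) := nPi.
have e2 : \sum_x n2 x = \sum_y beta y * sqmod ((Q *m u) y 0) := nPi'.
have e3 : \sum_x g x * n1 x = \sum_y alpha y * sqmod ((Q *m u) y 0) := qY.
apply: (@le_trans _ _ (\sum_x ((g x + eta) * n1 x + (c ^+ 2 / eta + c) * n2 x))).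
  apply: ler_sum => x _; rewrite {1}eu mulmxDr mxE.
  exact: sqmod_cross.
clearbody n1 n2.
rewrite big_split/= -[X in _ + X <= _]mulr_sumr e2.
under eq_bigr do rewrite mulrDl.
rewrite big_split/= e3 -[X in _ + X + _ <= _]mulr_sumr e1 !mulr_sumr -!big_split/=.
by rewrite le_eqVlt; apply/orP; left; apply/eqP; apply: eq_bigr => y _; ring.
Qed.

Lemma rtrace_expmx n (X : 'M[C]_n) (x : 'I_n -> R) : X \is unitarymx ->
  rtrace (expmx (X ^t* *m rdiag x *m X)) = \sum_a expR (x a).
Proof.
move=> uX; rewrite /expmx herm_calcE// rtraceC mulmxA (unitary_adjr uX) mul1mx.
by rewrite /rtrace Rec_sum; apply: eq_bigr => a _; rewrite rdiagE eqxx.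
Qed.

(** Were the sum over V below exp (- b), [peierls] would push Tr exp of [logsum e] below exp (- h)
    for small e, since each eigenvector off V contributes a term that vanishes with e. So V is
    nonzero as soon as the divergence is finite. *)
Lemma support_opt (h b : R) : h < b ->
  (forall e, 0 < e -> expR (- h) <= rtrace (expmx (logsum e))) ->
  exists (Q : 'M[C]_d) (alpha beta : 'I_d -> R),
  [/\ Q \is unitarymx, (forall y, beta y = 0 \/ beta y = 1),
    (forall y, beta y = 0 -> quad k0 (col y (Q ^t*)) = alpha y
      /\ quad Zk (col y (Q ^t*)) = 0) &
    expR (- b) <= \sum_y (1 - beta y) * expR (alpha y)].
Proof.
move=> hb hT; have [Q [alpha [beta [zm [uQ b01 hk zm0 hq]]]]] := support_state.
exists Q, alpha, beta; split => //; first by move=> y; case: (b01 y) => [|[]]; [left|right].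
set Zt := \sum_y _; rewrite leNgt; apply/negP => Ztb.
pose g := b - h; have g0 : 0 < g by rewrite subr_gt0.
have g4 : 0 < g / 4 by rewrite divr_gt0.
have [c' hc'] := hq _ g4.
(* The margin left for the eigenvectors off V after two losses of g / 4, one from eta and one from
   [pinvsum * e]. *)
pose kappa := expR (- h - g / 4) - expR (g / 4 - b).
have k0' : 0 < kappa by rewrite subr_gt0 ltr_expR /g; lra.
pose A := d%:R * expR c' / kappa.
have A0 : 0 <= A by rewrite divr_ge0 ?(ltW k0')// mulr_ge0// expR_ge0.
(* The first summand gives [pinvsum * e] <= g / 4, the second brings the contribution off V below
   kappa; both through exp x >= 1 + x. *)
pose t := 4 * pinvsum / g + A / zm.
have pinvsum0 := pinvsum_ge0.
have t10 : 0 <= 4 * pinvsum / g by rewrite divr_ge0 ?mulr_ge0// ltW.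
have t20 : 0 <= A / zm by rewrite divr_ge0// ltW.
pose e := expR (- t); have e0 : 0 < e by exact: expR_gt0.
have lne : ln e = - t by rewrite /e expRK.
have c1e : pinvsum * e <= g / 4.
  rewrite /e expRN ler_pdivrMr ?expR_gt0//.
  have : 4 * pinvsum / g <= expR t by apply: le_trans (expR_ge1Dx _); rewrite /t; lra.
  by rewrite ler_pdivrMr//; lra.
have small : d%:R * expR (c' - zm * t) < kappa.
  rewrite expRD expRN mulrA ltr_pdivrMr ?expR_gt0// [kappa * _]mulrC -ltr_pdivrMr//.
  apply: lt_le_trans (expR_ge1Dx _); rewrite -/A.
  have : A / zm <= t by rewrite /t lerDr.
  by rewrite ler_pdivrMr// mulrC; lra.
have [X [x [uX eX]]] := herm_diagonalize (herm_sum (fun i x => ln (p i x + e))).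
rewrite -/(logsum e) in eX.
have := hT e e0; rewrite eX rtrace_expmx//.
have pe : \sum_a expR (x a) <= \sum_y expR (alpha y + g / 4 * (1 - beta y) + c' * beta y
   + pinvsum * e + ln e * zm * beta y).
  apply: (peierls uX uQ) => u; rewrite -eX.
  apply: (le_trans (quad_logsum_le u e0)); have [h1 h2] := hc' u.
  rewrite -(sum_sqmod_unitary u uQ).
  apply: (@le_trans _ _ (\sum_y ((alpha y + g / 4 * (1 - beta y)) + c' * beta y) *
        sqmod ((Q *m u) y 0) + pinvsum * e * (\sum_y sqmod ((Q *m u) y 0)) +
      ln e * (zm * \sum_y beta y * sqmod ((Q *m u) y 0)))).
    rewrite lerD ?lerD2r// ler_wnM2l// lne oppr_le0 /t addr_ge0//.
  rewrite !mulr_sumr -!big_split/= le_eqVlt; apply/orP; left; apply/eqP.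
  by apply: eq_bigr => y _; ring.
move=> /le_trans/(_ pe).
have -> : \sum_y expR (alpha y + g / 4 * (1 - beta y) + c' * beta y
   + pinvsum * e + ln e * zm * beta y) = expR (pinvsum * e) *
   \sum_y ((1 - beta y) * expR (alpha y) * expR (g / 4) + beta y * expR (c' - zm * t)).
  rewrite mulr_sumr; apply: eq_bigr => y _; rewrite lne.
  case: (b01 y) => [->|[-> ->]].
    by rewrite subr0 !mulr0 !addr0 !mulr1 mul0r addr0 mul1r -!expRD; congr expR; ring.
  rewrite (_ : (1 - 1) * expR 0 * _ + _ = expR (c' - zm * t)); last first.
    by rewrite subrr !mul0r add0r mul1r.
  by rewrite -expRD; congr expR; ring.
rewrite big_split/= -mulr_suml -/Zt => H.
have H1 : \sum_y beta y * expR (c' - zm * t) <= d%:R * expR (c' - zm * t).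
  rewrite mulr_natl -[d in leRHS]card_ord -sumr_const; apply: ler_sum => y _.
  by rewrite ler_piMl ?expR_ge0//; case: (b01 y) => [->|[-> _]].
have H2 : expR (- h - g / 4) <= Zt * expR (g / 4) + d%:R * expR (c' - zm * t).
  rewrite [leLHS]expRD [expR (- (g / 4))]expRN ler_pdivrMr ?expR_gt0//.
  apply: (le_trans H); rewrite mulrC.
  have S0 : 0 <= Zt * expR (g / 4) + \sum_y beta y * expR (c' - zm * t).
    rewrite addr_ge0//.
      rewrite mulr_ge0 ?expR_ge0// sumr_ge0// => y _; rewrite mulr_ge0 ?expR_ge0//.
      by case: (b01 y) => [->|[-> _]]; rewrite ?subr0 ?subrr.
    by apply: sumr_ge0 => y _; rewrite mulr_ge0 ?expR_ge0//; case: (b01 y) => [->|[-> _]].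
  apply: (@le_trans _ _ ((Zt * expR (g / 4) + \sum_y beta y * expR (c' - zm * t)) * expR (g / 4))).
    by rewrite ler_wpM2l// ler_expR.
  by rewrite ler_wpM2r ?expR_ge0// lerD2l.
have H3 : Zt * expR (g / 4) < expR (g / 4 - b).
  by rewrite expRD mulrC ltr_pM2l ?expR_gt0.
by rewrite /kappa in small; lra.
Qed.

End SupportLimit.

(** * The converse for the arbitrarily varying null hypothesis *)

Section ConversePart.
Context {R : realType} {r d : nat} (s : 'I_r -> R).
Local Notation C := R[i].
Context (s_ge0 : forall i, 0 <= s i) (s_sum : \sum_i s i = 1).

Lemma converse_part (rho : 'I_r -> 'M[C]_d) (h b eps : R) :
  (forall i, density (rho i)) -> h < b -> eps < 1 ->
  (forall e, 0 < e -> log_euclidean_pd s (fun i => rho i + (e%:C)%:M) <= h) ->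
  exists N : nat, forall n, (N <= n)%N -> forall M : 'M[C]_((r * d) ^ n),
    is_test M -> (type1_error (av_hypothesis s d n) M <= eps%:E)%E ->
    expR (- (n%:R * b)) <= type2_error (ntensmx (rho_state s rho) n) M.
Proof.
move=> hrho hb e1 hH.
have /choice[Pa hPa] : forall i, exists Pa : 'M[C]_d * ('I_d -> R),
    [/\ Pa.1 \is unitarymx, rho i = Pa.1 ^t* *m rdiag Pa.2 *m Pa.1 &
      forall x, 0 <= Pa.2 x].
  by move=> i; have [P [a [? ? ? _]]] := density_diag (hrho i); exists (P, a).
pose P i := (Pa i).1; pose p i := (Pa i).2.
have uP i : P i \is unitarymx by have [] := hPa i.
have eP i : rho i = (P i) ^t* *m rdiag (p i) *m P i by have [] := hPa i.
have p_ge0 i x : 0 <= p i x by have [_ _] := hPa i; exact.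
(* Makes the trace of the exponential positive, so that [ln] can be inverted. A state has trace 1,
   and an index i exists because the s_i sum to 1. *)
have d_gt0 : (0 < d)%N.
  rewrite lt0n; apply/eqP => d0.
  have i0 : 'I_r.
    case: (r) s s_sum => [s' |r' _ _]; last exact: ord0.
    by rewrite big_ord0 => /esym/eqP; rewrite oner_eq0.
  have := (hrho i0).2; rewrite /mxtrace big1 => [/esym/eqP|j _]; first by rewrite oner_eq0.
  by have := ltn_ord j; rewrite {2}d0.
have hT e : 0 < e -> expR (- h) <= rtrace (expmx (logsum s P p e)).
  move=> e0; have [X [x [uX eX]]] := herm_diagonalize (herm_sum s P (fun i x => ln (p i x + e))).
  have -> : rtrace (expmx (logsum s P p e)) = \sum_a expR (x a).
    by rewrite /logsum eX rtrace_expmx.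
  have sp : 0 < \sum_a expR (x a).
    rewrite (bigD1 (Ordinal d_gt0))//= ltr_wpDr ?expR_gt0//.
    by apply: sumr_ge0 => a _; exact: expR_ge0.
  have := hH e e0; rewrite /log_euclidean_pd.
  have -> : \sum_(i < r) (s i)%:C *: lnmx (rho i + (e%:C)%:M) = logsum s P p e.
    by apply: eq_bigr => i _; rewrite eP lnmx_shift.
  rewrite /logsum eX rtrace_expmx// lerNl => hl.
  by rewrite -[leRHS]lnK ?posrE// ler_expR.
pose b' := (h + b) / 2.
have hb' : h < b' by rewrite /b'; lra.
have [Q [alpha [beta [uQ b01 hk hZ]]]] := support_opt s_ge0 s_sum uP p_ge0 hb' hT.
set Zt := \sum_y _ in hZ.
have Z0 : 0 < Zt by apply: lt_le_trans hZ; exact: expR_gt0.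
pose q y := (1 - beta y) * expR (alpha y) / Zt.
have q_ge0 y : 0 <= q y.
  rewrite /q divr_ge0 ?(ltW Z0)// mulr_ge0 ?expR_ge0//.
  by case: (b01 y) => ->; rewrite ?subr0 ?subrr.
have q_sum : \sum_y q y = 1 by rewrite /q -mulr_suml mulfV// gt_eqF.
pose U := blk P; pose V : 'M[C]_(r * d) := blk (fun=> Q).
have uU : U \is unitarymx by exact: blk_unitary.
have uV : V \is unitarymx by exact: blk_unitary.
pose p' (u : 'I_(r * d)) := s (mxtens_unindex u).1 * p (mxtens_unindex u).1 (mxtens_unindex u).2.
pose q' (u : 'I_(r * d)) := s (mxtens_unindex u).1 * q (mxtens_unindex u).2.
have p'_ge0 u : 0 <= p' u by rewrite mulr_ge0.
have q'_ge0 u : 0 <= q' u by rewrite mulr_ge0.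
have q'_sum : \sum_u q' u = 1.
  rewrite sum_tens -[RHS]s_sum; apply: eq_bigr => i _.
  under eq_bigr do rewrite /q' mxtens_indexK/=.
  by rewrite -mulr_sumr q_sum mulr1.
have eW : U *m V ^t* = blk (fun i => P i *m Q ^t*) by rewrite /U /V blk_adj blkM.
(* An eigenvector y in V has zero quadratic form for [kersum], a sum of nonnegative terms, so its
   overlap with the kernel of each rho_i with s_i > 0 vanishes. *)
have kerE i x y : s i != 0 -> p i x = 0 -> q y * sqmod ((P i *m Q ^t*) x y) = 0.
  move=> si px; case: (b01 y) => [by0|by1]; last by rewrite /q by1 subrr !mul0r.
  have [_] := hk y by0; rewrite quad_kersum => z0.
  have t0 j : true -> 0 <= s j * \sum_x (p j x == 0)%:R * sqmod ((P j *m col y (Q ^t*)) x 0).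
    by move=> _; rewrite mulr_ge0// sumr_ge0// => k _; rewrite mulr_ge0 ?sqmod_ge0.
  have /eqP := psumr_eq0P t0 z0 (i := i) isT; rewrite mulf_eq0 (negbTE si)/= => /eqP z1.
  have t1 k : true -> 0 <= (p i k == 0)%:R * sqmod ((P i *m col y (Q ^t*)) k 0).
    by move=> _; rewrite mulr_ge0 ?sqmod_ge0.
  have := psumr_eq0P t1 z1 (i := x) isT; rewrite px eqxx mul1r mul_col_adj => ->.
  by rewrite mulr0.
have nszE i x j y : nsz q' U V (mxtens_index (i, x)) (mxtens_index (j, y)) =
    (i == j)%:R * (s i * (q y * sqmod ((P i *m Q ^t*) x y))).
  rewrite /nsz eW blk_sqmod /q' mxtens_indexK/=.
  by case: (eqVneq i j) => [<-|_]; rewrite ?mul0r ?mulr0 ?mul1r ?mulrA.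
have supp u v : p' u = 0 -> nsz q' U V u v = 0.
  case: (mxtens_indexP u) => i x; case: (mxtens_indexP v) => j y.
  rewrite /p' mxtens_indexK/= nszE => /eqP; rewrite mulf_eq0.
  have [->|si] := eqVneq (s i) 0; first by rewrite mul0r mulr0.
  by move=> /= /eqP px; rewrite kerE// !mulr0.
(* The terms ln s_i cancel, and ln (q y) - alpha y = - ln Zt for every y in V: equality in the Gibbs
   variational principle. *)
have rel : relent p' q' U V = - ln Zt.
  rewrite /relent sum_tens.
  transitivity (\sum_i \sum_x \sum_y s i * (q y * (ln (q y) * sqmod ((P i *m Q ^t*) x y) -
      ln (p i x) * sqmod ((P i *m Q ^t*) x y)))).
    apply: eq_bigr => i _; apply: eq_bigr => x _; rewrite sum_tens (bigD1 i)//=.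
    rewrite [X in _ + X]big1 ?addr0 => [|j ji]; last first.
      by rewrite big1// => y _; rewrite nszE eq_sym (negbTE ji) !mul0r.
    apply: eq_bigr => y _; rewrite nszE eqxx mul1r /llr /p' /q' !mxtens_indexK/=.
    have [->|si] := eqVneq (s i) 0; first by rewrite !mul0r.
    have [w0|w0] := eqVneq (q y * sqmod ((P i *m Q ^t*) x y)) 0.
      by rewrite w0 mulr0 mul0r -mulrBl [q y * (_ * _)]mulrCA w0 !mulr0.
    have px : 0 < p i x.
      by rewrite lt_def p_ge0 andbT; apply: contra w0 => /eqP /(kerE _ _ _ si) ->.
    have qy : 0 < q y.
      by rewrite lt_def q_ge0 andbT; apply: contra w0 => /eqP ->; rewrite mul0r.
    have sp : 0 < s i by rewrite lt_def si s_ge0.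
    have l1 : ln (s i * q y) = ln (s i) + ln (q y) by rewrite lnM ?posrE.
    have l2 : ln (s i * p i x) = ln (s i) + ln (p i x) by rewrite lnM ?posrE.
    rewrite l1 l2; move: (ln (s i)) (ln (q y)) (ln (p i x)) (sqmod _) (q y) => *.
    by ring.
  transitivity (\sum_y q y * (ln (q y) - quad (logsupp s P p) (col y (Q ^t*)))).
    under eq_bigr do rewrite exchange_big/=.
    rewrite exchange_big/=; apply: eq_bigr => y _; rewrite quad_logsupp.
    transitivity (\sum_i q y * (s i * ln (q y) - s i * \sum_x ln (p i x) *
        sqmod ((P i *m col y (Q ^t*)) x 0))).
      apply: eq_bigr => i _; rewrite -mulr_sumr -mulr_sumr mulrCA; congr (_ * _).
      have u2 : P i *m Q ^t* \is unitarymx by apply: mul_adj_unitary.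
      rewrite sumrB -mulr_sumr (unitary_colsum y u2) mulr1 mulrBr.
      by under [in RHS]eq_bigr do rewrite mul_col_adj.
    by rewrite -mulr_sumr sumrB -mulr_suml s_sum mul1r.
  rewrite -[RHS]mul1r -q_sum mulr_suml; apply: eq_bigr => y _.
  case: (b01 y) => [by0|by1]; last by rewrite /q by1 subrr !mul0r.
  have [ek _] := hk y by0.
  have eq : ln (q y) = alpha y - ln Zt.
    by rewrite /q by0 subr0 mul1r ln_div ?posrE ?expR_gt0// expRK.
  by rewrite ek eq (_ : alpha y - ln Zt - alpha y = - ln Zt)//; ring.
(* [strong_converse] loses 3 delta, and the relative entropy is at most b'. *)
pose delta := (b - b') / 3.
have delta0 : 0 < delta by rewrite /delta /b'; lra.
have [N hN] := strong_converse p'_ge0 q'_ge0 q'_sum uU uV supp delta0 e1.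
exists N => n /hN {}hN M tM t1.
pose om := Q ^t* *m rdiag q *m Q.
have dom : density om.
  split; first by apply/psdmx_rdiag.
  rewrite /om mxtrace_mulC mulmxA unitary_adjr// mul1mx -[RHS]/(1%:C) -q_sum sumC.
  by apply: eq_bigr => x _; rewrite rdiagE eqxx.
have eS : V ^t* *m rdiag q' *m V = pi_state s *t om.
  rewrite pi_state_tens /q' -(blk_rdiag (fun i x => s i * q x)) /V blk_adj !blkM.
  by apply: eq_blk => i; rewrite rdiagZ -scalemxAr -scalemxAl.
have eR : U ^t* *m rdiag p' *m U = rho_state s rho.
  rewrite rho_state_blk /p' -(blk_rdiag (fun i x => s i * p i x)) /U blk_adj !blkM.
  by apply: eq_blk => i; rewrite eP rdiagZ -scalemxAr -scalemxAl.
rewrite /type2_error -bigtens_const -eR.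
apply: le_trans (hN M tM _); last first.
  rewrite eS -lee_fin; apply: le_trans t1; apply: ereal_sup_ubound.
  exists (bigtens (fun _ : 'I_n => pi_state s *t om)) => //.
  by exists (fun=> om).
rewrite ler_expR lerN2 ler_wpM2l//.
have : - ln Zt <= b'.
  by rewrite lerNl -[- b']expRK ler_ln ?posrE ?expR_gt0.
by rewrite rel /delta; lra.
Qed.

End ConversePart.

(** * Limits in the extended reals and the conclusion *)

Lemma cvge_order (R : realType) (u : (\bar R)^nat) (l : \bar R) :
  l != -oo%E ->
  (forall b : R, (b%:E < l)%E -> \forall n \near \oo, (b%:E <= u n)%E) ->
  (forall b : R, (l < b%:E)%E -> \forall n \near \oo, (u n <= b%:E)%E) ->
  u @ \oo --> l.
Proof.
case: l => [l| |] // _ hlo hhi; last first.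
  by apply/cvgeyPge => A; apply: hlo; rewrite ltry.
have lo e : 0 < e -> \forall n \near \oo, ((l - e)%:E <= u n)%E.
  by move=> e0; apply: hlo; rewrite lte_fin ltrBlDr ltrDl.
have hi e : 0 < e -> \forall n \near \oo, (u n <= (l + e)%:E)%E.
  by move=> e0; apply: hhi; rewrite lte_fin ltrDl.
apply/fine_cvgP; split.
  near=> n.
  have h1 : ((l - 1)%:E <= u n)%E by near: n; exact: lo.
  have h2 : (u n <= (l + 1)%:E)%E by near: n; exact: hi.
  by case: (u n) h1 h2.
apply/cvgrPdist_le => e e0; near=> n.
have h1 : ((l - e)%:E <= u n)%E by near: n; exact: lo.
have h2 : (u n <= (l + e)%:E)%E by near: n; exact: hi.
rewrite /=; case: (u n) h1 h2 => [x| |] //; rewrite !lee_fin /= => h1 h2.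
by rewrite ler_norml; apply/andP; split; lra.
Unshelve. all: by end_near.
Qed.

Lemma lne_le_expR (R : realType) (x : \bar R) (a : R) :
  (x <= (expR a)%:E -> lne x <= a%:E)%E.
Proof.
case: x => [x xa| |_]; [|by rewrite leye_eq|by rewrite le0_lneNy ?leNye// leNye].
rewrite lee_fin in xa.
case: (leP x 0) => x0; first by rewrite le0_lneNy ?lee_fin// leNye.
by rewrite lne_EFin// lee_fin -[leRHS]expRK ler_ln ?posrE ?expR_gt0.
Qed.

Lemma lne_ge_expR (R : realType) (x : \bar R) (a : R) :
  ((expR a)%:E <= x -> a%:E <= lne x)%E.
Proof.
case: x => [x| |] // xa; last by rewrite /= leey.
rewrite lee_fin in xa; have x0 : 0 < x by apply: lt_le_trans xa; exact: expR_gt0.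
by rewrite lne_EFin// lee_fin -[leLHS]expRK ler_ln ?posrE ?expR_gt0.
Qed.

Lemma rtrace_expmx_ge0 (R : realType) n (A : 'M[R[i]]_n) : 0 <= rtrace (expmx A).
Proof.
rewrite /expmx /herm_calc rtraceC mulmxA mulmxV ?spectral_unit// mul1mx.
rewrite /rtrace Rec_sum sumr_ge0// => a _.
by rewrite !mxE eqxx mulr1n expR_ge0.
Qed.

Theorem mainTheorem13 (R : realType) (r d : nat) (s : 'I_r -> R)
    (hs0 : forall i, 0 <= s i) (hs1 : \sum_(i < r) s i = 1)
    (rho : 'I_r -> 'M[R[i]]_d) (hrho : forall i, density (rho i))
    (eps : R) (heps : 0 < eps < 1) :
  ((n%:R^-1)%:E *
     hypothesis_testing_div eps (av_hypothesis s d n)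
       (ntensmx (rho_state s rho) n))%E @[n --> \oo]
  --> log_euclidean s rho.
Proof.
have /andP[e0 e1] := heps.
have pd_le e : 0 < e ->
    ((log_euclidean_pd s (fun i => rho i + (e%:C)%:M))%:E <= log_euclidean s rho)%E.
  by move=> he; apply: ereal_sup_ubound; exists e.
apply: cvge_order.
- by apply/eqP => h; have := pd_le 1 ltr01; rewrite h.
- move=> b /ereal_sup_gt[_ [e he <-]]; rewrite lte_fin; set h := log_euclidean_pd _ _ => bh.
  have hb : 0 < h - b by rewrite subr_gt0.
  have [N hN] := direct_part hs0 hs1 hrho he hb e0.
  exists N.+1 => // n /= Nn; have n0 : (0 < n)%N by exact: leq_ltn_trans Nn.
  have [M [tM t1 t2]] := hN n (ltnW Nn).
  rewrite lee_pdivlMl ?ltr0n// -EFinM /hypothesis_testing_div leeNr -EFinN.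
  apply: lne_le_expR; apply: (@le_trans _ _ (type2_error (ntensmx (rho_state s rho) n) M)%:E).
    by apply: ereal_inf_lbound; exists M.
  rewrite lee_fin; apply: (le_trans t2).
  have := rtrace_expmx_ge0 (\sum_i (s i)%:C *: lnmx (rho i + (e%:C)%:M)).
  (* The case T = 0 is separated because ln 0 = 0 breaks T = exp (ln T); there the power T^n is 0,
     as n > 0. *)
  rewrite /h /log_euclidean_pd; set T := rtrace _; rewrite le_eqVlt => /orP[/eqP<-|T0].
    by rewrite expr0n eqn0Ngt n0/= mulr0 expR_ge0.
  rewrite -{2}[T]lnK ?posrE// -expRM_natl -expRD ler_expR.
  by rewrite le_eqVlt; apply/orP; left; apply/eqP; rewrite -mulr_natl; ring.
- move=> b Hb.
  (* The divergence is below b and above its value at e = 1, hence finite, as [converse_part]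
     requires. *)
  have [h eh] : exists h : R, log_euclidean s rho = h%:E.
    case: (log_euclidean s rho) Hb (pd_le 1 ltr01) => [h| |] //=.
    by exists h.
  have hb : h < b by rewrite -lte_fin -eh.
  have hH e : 0 < e -> log_euclidean_pd s (fun i => rho i + (e%:C)%:M) <= h.
    by move=> he; rewrite -lee_fin -eh; exact: pd_le.
  have [N hN] := converse_part hs0 hs1 hrho hb e1 hH.
  exists N.+1 => // n /= Nn; have n0 : (0 < n)%N by exact: leq_ltn_trans Nn.
  rewrite lee_pdivrMl ?ltr0n// -EFinM /hypothesis_testing_div leeNl -EFinN.
  apply: lne_ge_expR; apply: le_ereal_inf_tmp => _ [M [tM t1] <-].
  by rewrite lee_fin; exact: hN (ltnW Nn) M tM t1.
Qed.
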